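(* Let $(X,\bullet)$ be a pointed, path-connected diffeological space. The projection $\tau:\mathcal F_\bullet(X)\to X$, $\tau([\alpha])=\alpha(1)$, with the right action $([\alpha],[\gamma])\mapsto[\alpha]\vee[\gamma]:=[\alpha\vee\gamma]$ of $\Omega_\bullet(X)$ on $\mathcal F_\bullet(X)$, is a diffeological principal $\Omega_\bullet(X)$-bundle.
   Context: Diffeological spaces, plots, smooth maps, and the subspace, product, quotient and functional diffeologies are the standard ones; $[0,1]\subseteq\mathbb R$ has the subspace diffeology. $X$ is path-connected if any two points lie in the image of some plot of $X$ defined on an open interval of $\mathbb R$. A diffeological group is a group with a diffeology making multiplication and inversion smooth. For a diffeological group $G$, a diffeological principal $G$-bundle is a smooth surjection $\pi:E\to X$ with a smooth right $G$-action on $E$ such that $E\times G\to E\times E$, $(p,g)\mapsto(p,pg)$, is a diffeomorphism onto its image, and there is a diffeomorphism $X\to E/G$ sending $\pi(\xi)$ to $\xi\cdot G$ for all $\xi\in E$. Path spaces. $C^\infty([0,1],X)$ has the functional diffeology. Let $C^\infty_\sim([0,1],X)=C^\infty([0,1],X)/\!\sim$, where $\alpha\sim\beta$ iff there is $f\in\mathrm{Diff}([0,1])$ with $f(0)=0$, $f(1)=1$ and $\alpha=\beta\circ f$; the class of $\alpha$ is $\ulcorner\alpha\urcorner$. For $\alpha,\beta$ with $\beta(0)=\alpha(1)$, the concatenation is $(\beta\vee\alpha)(t)=\alpha(2t)$ for $t<1/2$ and $\beta(2t-1)$ for $t\ge1/2$, and $\ulcorner\beta\urcorner\vee\ulcorner\alpha\urcorner=\ulcorner\beta\vee\alpha\urcorner$,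 with representatives chosen constant near $0$ and $1$. Retrace equivalence is the equivalence relation on $C^\infty_\sim([0,1],X)$ generated by the operations $\ulcorner\beta\urcorner\vee\ulcorner\alpha\urcorner\mapsto\ulcorner\beta\urcorner\vee\ulcorner\eta\urcorner\vee\ulcorner\eta^{\leftarrow}\urcorner\vee\ulcorner\alpha\urcorner$ for $\ulcorner\eta\urcorner\in C^\infty_\sim([0,1],X)$, where $\eta^{\leftarrow}(t)=\eta(1-t)$. $\mathcal F(X)$ is the quotient of $C^\infty_\sim([0,1],X)$ by retrace equivalence, with the quotient diffeology; the class of $\alpha\in C^\infty([0,1],X)$ is $[\alpha]$. By convention, the representative $\alpha$ of a given $[\alpha]\in\mathcal F(X)$ is assumed constant near $0$ and $1$. $\mathcal F_\bullet(X)=\{[\alpha]:\alpha(0)=\bullet\}$ and $\Omega_\bullet(X)=\{[\gamma]:\gamma(0)=\bullet=\gamma(1)\}$ have the subspace diffeology; $\Omega_\bullet(X)$ is a diffeological group under $[\gamma]\vee[\sigma]=[\gamma\vee\sigma]$, $[\gamma]^{-1}=[\gamma^{\leftarrow}]$. *)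

(* Defs.v *)
From HB Require Import structures.
From mathcomp Require Import all_boot all_order all_algebra.
From mathcomp Require Import all_classical reals topology normedtype landau derive.
From mathcomp Require Import lra.
From Stdlib Require Import Relation_Operators.

Set Implicit Arguments.
Unset Strict Implicit.
Unset Printing Implicit Defensive.

Import Order.TTheory GRing.Theory Num.Theory.
Import numFieldNormedType.Exports.

Local Open Scope classical_set_scope.
Local Open Scope ring_scope.

Section smooth_on.
Context {R : realType} {V W : normedModType R}.

(* [f] is [k] times (Frechet) differentiable on [U]: it is differentiable there
   and its derivative in each fixed direction is [k - 1] times differentiable. *)
Fixpoint diffn (k : nat) (U : set V) (f : V -> W) : Prop :=
  if k is k'.+1 then
    (forall x, U x -> differentiable f x) /\ (forall v, diffn k' U ('D_v f))
  else True.

Definition smooth_on (U : set V) (f : V -> W) : Prop := forall k, diffn k U f.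

End smooth_on.

Section smooth_on_theory.
Context {R : realType}.
Implicit Types V W : normedModType R.

Lemma near_eq_differentiable V W (f g : V -> W) x :
  {near x, f =1 g} -> differentiable f x -> differentiable g x.
Proof.
move=> fg dfx; have gfx : g x = f x by rewrite (nbhs_singleton fg).
have H : g \o shift x = cst (g x) + ('d f x : V -> W) +o_ 0 id.
  apply/eqaddoP => e e0.
  have /eqaddoP/(_ e e0) := diff_locally dfx.
  have : \forall h \near (0 : V), f (h + x) = g (h + x).
    have cx : (fun h : V => h + x) @ (0 : V) --> x.
      rewrite -[X in _ --> X]add0r; apply: cvgD; [exact: cvg_id|exact: cvg_cst].
    exact: (cx _ fg).
  apply: filterS2 => h fgh /=.
  by rewrite !fctE /= gfx fgh.
have c : continuous ('d f x) by exact: diff_continuous.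
have E := diff_unique c H.
by apply/diff_locallyP; rewrite E; split.
Qed.

Lemma open_near_eq V W (U : set V) (f g : V -> W) x : open U ->
  {in U, f =1 g} -> U x -> {near x, f =1 g}.
Proof.
move=> oU fg Ux.
have : nbhs x U by apply: open_nbhs_nbhs.
by apply: filterS => y Uy; apply: fg; rewrite inE.
Qed.

Lemma eq_diffn k V W (U : set V) (f g : V -> W) : open U ->
  {in U, f =1 g} -> diffn k U f -> diffn k U g.
Proof.
move=> oU; elim: k f g => //= k IH f g fg [df Df]; split.
  by move=> x Ux; apply: near_eq_differentiable (df _ Ux); exact: open_near_eq Ux.
move=> v; apply: IH (Df v) => x; rewrite inE => Ux.
by apply: near_eq_derive; exact: open_near_eq Ux.
Qed.

Lemma diffn_sub k V W (U U' : set V) (f : V -> W) :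
  U' `<=` U -> diffn k U f -> diffn k U' f.
Proof.
move=> UU; elim: k f => //= k IH f [df Df]; split=> [x /UU/df//|v].
exact: IH.
Qed.

Lemma diffnW k V W (U : set V) (f : V -> W) : diffn k.+1 U f -> diffn k U f.
Proof.
elim: k f => // k IH f [df Df]; split=> // v; apply: IH; exact: Df.
Qed.

Lemma diffn_cst k V W (U : set V) (a : W) : diffn k U (fun _ : V => a).
Proof.
elim: k a => //= k IH a; split=> [x _|v]; first exact: differentiable_cst.
rewrite (_ : 'D_v _ = fun=> 0) //; apply/funext => x; exact: derive_cst.
Qed.

Lemma diffn_lin k V W (U : set V) (f : {linear V -> W}) :
  continuous f -> diffn k U f.
Proof.
case: k => //= k cf; split=> [x _|v]; first exact: linear_differentiable.
rewrite (_ : 'D_v f = fun=> f v); first exact: diffn_cst.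
by apply/funext => x; rewrite deriveE ?diff_lin//; exact: linear_differentiable.
Qed.

Lemma diffnD k V W (U : set V) (f g : V -> W) : open U ->
  diffn k U f -> diffn k U g -> diffn k U (fun x => f x + g x).
Proof.
move=> oU; elim: k f g => //= k IH f g [df Df] [dg Dg]; split=> [x Ux|v].
  by apply: differentiableD; [exact: df|exact: dg].
apply: (@eq_diffn _ _ _ _ (fun x => 'D_v f x + 'D_v g x)) => //.
  move=> x; rewrite inE => Ux; rewrite -deriveD//; apply: diff_derivable.
    exact: df.
  exact: dg.
exact: IH.
Qed.

Lemma diffn_sum k V W (U : set V) m (f : 'I_m -> V -> W) : open U ->
  (forall i, diffn k U (f i)) -> diffn k U (fun x => \sum_(i < m) f i x).
Proof.
move=> oU; elim: m f => [|m IH] f df.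
  apply: (@eq_diffn _ _ _ _ (fun=> 0)) => //; last exact: diffn_cst.
  by move=> x _; rewrite big_ord0.
apply: (@eq_diffn _ _ _ _ (fun x =>
  f ord0 x + \sum_(i < m) f (lift ord0 i) x)) => //.
  by move=> x _; rewrite big_ord_recl.
by apply: diffnD => //; apply: IH.
Qed.

Lemma scaler_bilin W : bilinear_for
    (GRing.Scale.Law.clone _ _ *:%R _) (GRing.Scale.Law.clone _ _ *:%R _)
    (@GRing.scale R W).
Proof.
split=> [u'|u] a x y /=.
- by rewrite scalerDl scalerA.
- by rewrite scalerDr !scalerA mulrC.
Qed.
HB.instance Definition _ W := bilinear_isBilinear.Build R R W W _ _
  (@GRing.scale R W) (@scaler_bilin W).

Lemma scale_differentiable V W (c : V -> R) (f : V -> W) x v :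
  differentiable c x -> differentiable f x ->
  differentiable (fun y => c y *: f y) x /\
  'D_v (fun y => c y *: f y) x = c x *: 'D_v f x + 'D_v c x *: f x.
Proof.
move=> dc df.
have cs : continuous (fun p : R * W => p.1 *: p.2) by move=> p; exact: scale_continuous.
have dp := differentiable_pair dc df.
have ds := @differentiable_bilin R R W W (@GRing.scale R W) (c x, f x) cs.
have dcf := differentiable_comp dp ds.
split; first exact: dcf.
rewrite !deriveE//.
rewrite (_ : (fun y => c y *: f y) = (fun p => p.1 *: p.2) \o (fun y => (c y, f y)))//.
rewrite (diff_comp dp ds) /= (@diff_bilin R R W W (@GRing.scale R W) (c x, f x))//.
by rewrite (diff_pair dc df).
Qed.

Lemma diffnZ k V W (U : set V) (c : V -> R) (f : V -> W) : open U ->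
  diffn k U c -> diffn k U f -> diffn k U (fun x => c x *: f x).
Proof.
move=> oU; elim: k c f => // k IH c f Hc Hf.
have [dc Dc] := Hc; have [df Df] := Hf; split=> [x Ux|v].
  by have [] := scale_differentiable 0 (dc x Ux) (df x Ux).
apply: (@eq_diffn _ _ _ _ (fun x => c x *: 'D_v f x + 'D_v c x *: f x)) => //.
  move=> x; rewrite inE => Ux.
  by have [_ ->] := scale_differentiable v (dc x Ux) (df x Ux).
apply: diffnD => //; apply: IH;
  [exact: diffnW Hc|exact: Df|exact: Dc|exact: diffnW Hf].
Qed.

Lemma coord_lin n (j : 'I_n) : linear (fun M : 'rV[R]_n => M 0 j : R).
Proof. by move=> a x y; rewrite !mxE. Qed.

Lemma diffn_coord k V (U : set V) n (f : V -> 'rV[R]_n) j : open U ->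
  diffn k U f -> diffn k U (fun x => f x 0 j : R).
Proof.
move=> oU; elim: k f => //= k IH f [df Df].
pose L : {linear 'rV[R]_n -> R} := HB.pack (fun M : 'rV[R]_n => M 0 j : R)
  (GRing.isLinear.Build _ _ _ _ _ (@coord_lin n j)).
have cL : continuous L by exact: coord_continuous.
have dL x : differentiable L x by exact: linear_differentiable.
split=> [x Ux|v]; first exact: (differentiable_comp (df x Ux) (dL _)).
apply: (@eq_diffn _ _ _ _ (fun x => 'D_v f x 0 j : R)) => //; last exact: IH.
move=> x; rewrite inE => Ux; rewrite -[in RHS]/(L \o f).
rewrite (deriveE _ (df x Ux)) (deriveE _ (differentiable_comp (df x Ux) (dL _))).
by rewrite (diff_comp (df x Ux) (dL _)) [RHS]/comp (diff_lin _ cL).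
Qed.

Lemma diffn_comp k V n W (U : set V) (U' : set 'rV[R]_n)
    (f : V -> 'rV[R]_n) (g : 'rV[R]_n -> W) : open U ->
  (forall x, U x -> U' (f x)) -> diffn k U f -> diffn k U' g ->
  diffn k U (g \o f).
Proof.
move=> oU UU'; elim: k f g UU' => // k IH f g UU' Hf Hg.
have [df Df] := Hf; have [dg Dg] := Hg.
have dgf x : U x -> differentiable (g \o f) x.
  by move=> Ux; apply: differentiable_comp; [exact: df|apply: dg; exact: UU'].
split=> [//|v].
apply: (@eq_diffn _ _ _ _ (fun x => \sum_(j < n)
  ('D_v f x 0 j : R) *: ('D_(delta_mx 0 j) g \o f) x)) => //.
  move=> x; rewrite inE => Ux.
  have dgfx := dg _ (UU' _ Ux); have dfx := df _ Ux.
  rewrite [RHS]deriveE; last exact: dgf.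
  rewrite (diff_comp dfx dgfx) /= deriveE //.
  rewrite [in RHS](row_sum_delta ('d f x v)) linear_sum /=.
  by apply: eq_bigr => j _; rewrite linearZ/= deriveE.
apply: diffn_sum => // j; apply: diffnZ => //.
  by apply: diffn_coord => //; exact: Df.
by apply: IH => //; [exact: diffnW Hf|exact: Dg].
Qed.

Lemma smooth_on_continuous V W (U : set V) (f : V -> W) x :
  smooth_on U f -> U x -> {for x, continuous f}.
Proof. by move=> /(_ 1%N) [df _] /df; exact: differentiable_continuous. Qed.

Lemma smooth_on_comp V n W (U : set V) (U' : set 'rV[R]_n)
    (f : V -> 'rV[R]_n) (g : 'rV[R]_n -> W) : open U ->
  (forall x, U x -> U' (f x)) -> smooth_on U f -> smooth_on U' g ->
  smooth_on U (g \o f).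
Proof. by move=> oU UU' sf sg k; apply: diffn_comp UU' (sf k) (sg k). Qed.

Lemma diffn_local k V W (U : set V) (f : V -> W) :
  (forall x, U x -> exists2 U', U' x & diffn k U' f) -> diffn k U f.
Proof.
elim: k f => //= k IH f H; split=> [x /H [U' U'x [df _]]|v]; first exact: df.
by apply: IH => x /H [U' U'x [_ Df]]; exists U'.
Qed.

Lemma smooth_on_id V (U : set V) : smooth_on U (fun x : V => x).
Proof. by move=> k; apply: (@diffn_lin _ _ _ _ (idfun : {linear V -> V})) => x. Qed.

End smooth_on_theory.

(* Plots are total functions on R^n, of which only the values on the open set
   [U] matter ([plot_eq]). *)
Record diffSpace (R : realType) := DiffSpace {
  carrier :> Type ;
  plot : forall n, set 'rV[R]_n -> ('rV[R]_n -> carrier) -> Prop ;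
  plot_open : forall n (U : set 'rV[R]_n) P, plot U P -> open U ;
  plot_eq : forall n (U : set 'rV[R]_n) P Q,
    (forall u, U u -> P u = Q u) -> plot U P -> plot U Q ;
  plot_cst : forall n (U : set 'rV[R]_n) x, open U -> plot U (fun=> x) ;
  plot_comp : forall n m (U : set 'rV[R]_n) (V : set 'rV[R]_m) P
      (r : 'rV[R]_m -> 'rV[R]_n),
    plot U P -> open V -> smooth_on V r -> (forall v, V v -> U (r v)) ->
    plot V (P \o r) ;
  plot_local : forall n (U : set 'rV[R]_n) P,
    (forall u, U u -> exists V, [/\ V u, V `<=` U & plot V P]) -> plot U P
}.
Arguments plot {R} d {n} U P.

Definition smooth {R : realType} (X Y : diffSpace R) (f : X -> Y) : Prop :=
  forall n (U : set 'rV[R]_n) (P : 'rV[R]_n -> X),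
    plot X U P -> plot Y U (f \o P).
Arguments smooth {R} X Y f.

Definition diffeomorphism {R : realType} (X Y : diffSpace R) (f : X -> Y) :
    Prop :=
  smooth X Y f /\ exists g, [/\ smooth Y X g, cancel f g & cancel g f].
Arguments diffeomorphism {R} X Y f.

Section plot_theory.
Context {R : realType}.
Implicit Type X : diffSpace R.

Lemma plot_sub X n (U V : set 'rV[R]_n) (P : 'rV[R]_n -> X) :
  open V -> V `<=` U -> plot X U P -> plot X V P.
Proof.
move=> oV VU pP.
exact: (plot_comp pP oV (@smooth_on_id R _ V) VU).
Qed.

Lemma open_local n (U : set 'rV[R]_n) :
  (forall u, U u -> exists V, [/\ V u, V `<=` U & open V]) -> open U.
Proof.
move=> H; rewrite openE => u /H [V [Vu VU oV]].
by rewrite /interior; apply: (@filterS _ _ _ V) => //; apply: open_nbhs_nbhs.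
Qed.

Lemma open_preimage n (W : normedModType R) (U : set 'rV[R]_n) (A : set W)
    (f : 'rV[R]_n -> W) :
  open U -> smooth_on U f -> open A -> open (U `&` f @^-1` A).
Proof.
move=> oU sf oA; rewrite openE => u [Uu Au].
rewrite /interior; apply: filterI; first exact: open_nbhs_nbhs.
apply: (smooth_on_continuous sf Uu); exact: open_nbhs_nbhs.
Qed.

End plot_theory.

Section constructions.
Context {R : realType}.

Section real.

Definition real_plot n (U : set 'rV[R]_n) (P : 'rV[R]_n -> R) : Prop :=
  open U /\ smooth_on U P.

Program Definition realSpace : diffSpace R :=
  @DiffSpace R R (fun n U P => @real_plot n U P) _ _ _ _ _.
Next Obligation. by move=> n U P []. Qed.
Next Obligation.
move=> n U P Q PQ [oU sP]; split=> // k; apply: eq_diffn (sP k) => // u.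
by rewrite inE; exact: PQ.
Qed.
Next Obligation. by move=> n U x oU; split=> // k; exact: diffn_cst. Qed.
Next Obligation.
move=> n m U V P r [oU sP] oV sr rV; split=> //; exact: smooth_on_comp rV sr sP.
Qed.
Next Obligation.
move=> n U P H; split.
  by apply: open_local => u /H [V [Vu VU [oV _]]]; exists V.
by move=> k; apply: diffn_local => u /H [V [Vu VU [_ sP]]]; exists V.
Qed.

End real.

Section sub.
Variables (X : diffSpace R) (A : set X).

Program Definition subSpace : diffSpace R :=
  @DiffSpace R {x : X | A x}
    (fun n U P => plot X U (fun u => sval (P u))) _ _ _ _ _.
Next Obligation. by move=> n U P; exact: plot_open. Qed.
Next Obligation.
by move=> n U P Q PQ; apply: plot_eq => u Uu; rewrite PQ.
Qed.
Next Obligation. by move=> n U x oU; exact: plot_cst. Qed.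
Next Obligation.
by move=> n m U V P r pP oV sr rV; exact: (plot_comp pP oV sr rV).
Qed.
Next Obligation. by move=> n U P H; exact: plot_local. Qed.

End sub.

Section prod.
Variables (X Y : diffSpace R).

Program Definition prodSpace : diffSpace R :=
  @DiffSpace R (X * Y)%type
    (fun n U P => plot X U (fun u => (P u).1) /\ plot Y U (fun u => (P u).2))
    _ _ _ _ _.
Next Obligation. by move=> n U P [+ _]; exact: plot_open. Qed.
Next Obligation.
move=> n U P Q PQ [p1 p2].
by split; [apply: plot_eq p1|apply: plot_eq p2] => u Uu; rewrite PQ.
Qed.
Next Obligation. by move=> n U x oU; split; exact: plot_cst. Qed.
Next Obligation.
move=> n m U V P r [p1 p2] oV sr rV.
by split; [exact: (plot_comp p1 oV sr rV)|exact: (plot_comp p2 oV sr rV)].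
Qed.
Next Obligation.
move=> n U P H; split; apply: plot_local => u /H [V [Vu VU [p1 p2]]];
  by exists V.
Qed.

End prod.

Section quot.
Variables (X : diffSpace R) (E : X -> X -> Prop).

(* The points of the quotient are the classes [[set y | E x y]]; all relations
   used below are equivalence relations. *)
Definition quot : Type := {C : set X | exists x, C = E x}.

Definition cls (x : X) : quot := exist _ (E x : set X) (ex_intro _ x erefl).

Definition quot_plot n (U : set 'rV[R]_n) (P : 'rV[R]_n -> quot) : Prop :=
  open U /\ forall u, U u -> exists V (Q : 'rV[R]_n -> X),
    [/\ V u, V `<=` U, plot X V Q & forall v, V v -> P v = cls (Q v)].

Program Definition quotSpace : diffSpace R :=
  @DiffSpace R quot (fun n U P => @quot_plot n U P) _ _ _ _ _.
Next Obligation. by move=> n U P []. Qed.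
Next Obligation.
move=> n U P Q PQ [oU H]; split=> // u /H [V [P' [Vu VU pP' PP']]].
by exists V, P'; split=> // v Vv; rewrite -PQ ?PP'//; exact: VU.
Qed.
Next Obligation.
move=> n U C oU; split=> // u Uu; case: C => C [x Cx].
exists U, (fun=> x); split=> //; first exact: plot_cst.
by move=> v _; exact: eq_exist.
Qed.
Next Obligation.
move=> n m U V P r [oU H] oV sr rV; split=> // v Vv.
have [U' [Q [U'u U'U pQ PQ]]] := H _ (rV _ Vv).
have oV' := open_preimage oV sr (plot_open pQ).
exists (V `&` r @^-1` U'), (Q \o r); split=> //.
- by apply: (plot_comp pQ) => //; [move=> k; apply: diffn_sub (sr k) => ? []|move=> ? []].
- by move=> w [_ /PQ].
Qed.
Next Obligation.
move=> n U P H; split.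
  by apply: open_local => u /H [V [Vu VU [oV _]]]; exists V.
move=> u /H [V [Vu VU [_ /(_ _ Vu) [V' [Q [V'u V'V pQ PQ]]]]]].
by exists V', Q; split=> //; exact: subset_trans VU.
Qed.

End quot.

Section func.
Variables (X Y : diffSpace R).

(* [P : U -> C^oo(X, Y)] is a plot iff [(u, x) |-> P u x] is smooth on [U * X],
   i.e. sends each pair of a smooth map [r : V -> U] and a plot [Q : V -> X] to
   a plot of [Y]. *)
Definition fun_plot n (U : set 'rV[R]_n)
    (P : 'rV[R]_n -> {f : X -> Y | smooth X Y f}) : Prop :=
  open U /\ forall m (V : set 'rV[R]_m) (r : 'rV[R]_m -> 'rV[R]_n) Q,
    smooth_on V r -> (forall v, V v -> U (r v)) -> plot X V Q ->
    plot Y V (fun v => sval (P (r v)) (Q v)).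

Program Definition funSpace : diffSpace R :=
  @DiffSpace R {f : X -> Y | smooth X Y f} (fun n U P => @fun_plot n U P)
    _ _ _ _ _.
Next Obligation. by move=> n U P []. Qed.
Next Obligation.
move=> n U P P' PP' [oU H]; split=> // m V r Q sr rV pQ.
by apply: plot_eq (H _ _ _ _ sr rV pQ) => v Vv; rewrite PP'//; exact: rV.
Qed.
Next Obligation.
by move=> n U [f sf] oU; split=> // m V r Q _ _ pQ; exact: sf pQ.
Qed.
Next Obligation.
move=> n m U V P r [oU H] oV sr rV; split=> // m' V' r' Q sr' r'V pQ.
apply: (H _ _ (r \o r')) => //; last by move=> v /r'V /rV.
exact: smooth_on_comp (plot_open pQ) r'V sr' sr.
Qed.
Next Obligation.
move=> n U P H; split.
  by apply: open_local => u /H [V [Vu VU [oV _]]]; exists V.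
move=> m V r Q sr rV pQ; apply: plot_local => v Vv.
have [U' [U'v U'U [oU' HU']]] := H _ (rV _ Vv).
have oV' := open_preimage (plot_open pQ) sr oU'.
exists (V `&` r @^-1` U'); split=> //.
apply: HU'; last by apply: plot_sub pQ => // ? [].
  by move=> k; apply: diffn_sub (sr k) => ? [].
by move=> w [].
Qed.

End func.

End constructions.
Arguments realSpace R : clear implicits.

Definition path_connected {R : realType} (X : diffSpace R) : Prop :=
  forall x y : X, exists (I : set R) (P : 'rV[R]_1 -> X),
    let U := [set u : 'rV[R]_1 | I (u 0 0)] in
    [/\ open I, is_interval I, plot X U P,
        (exists2 u, U u & P u = x) & (exists2 u, U u & P u = y)].

Section principal_bundle.
Context {R : realType}.

Record is_diffGroup (G : diffSpace R) (mul : G -> G -> G) (one : G)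
    (inv : G -> G) : Prop := {
  dg_mulA : associative mul ;
  dg_1mul : left_id one mul ;
  dg_mul1 : right_id one mul ;
  dg_Vmul : left_inverse one inv mul ;
  dg_mulV : right_inverse one inv mul ;
  dg_smooth_mul : smooth (prodSpace G G) G (fun z => mul z.1 z.2) ;
  dg_smooth_inv : smooth G G inv
}.

Definition image_space (X Y : diffSpace R) (f : X -> Y) : diffSpace R :=
  subSpace (range f).

Definition to_image (X Y : diffSpace R) (f : X -> Y) (x : X) :
  image_space f := exist _ (f x) (ex_intro2 _ _ x I erefl).

Record principal_bundle (G : diffSpace R) (mul : G -> G -> G) (one : G)
    (inv : G -> G) (E X : diffSpace R) (pi : E -> X) (act : E -> G -> E) :
    Prop := {
  pb_group : is_diffGroup mul one inv ;
  pb_smooth : smooth E X pi ;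
  pb_surj : forall x, exists e, pi e = x ;
  pb_act1 : forall e, act e one = e ;
  pb_actM : forall e g h, act (act e g) h = act e (mul g h) ;
  pb_smooth_act : smooth (prodSpace E G) E (fun z => act z.1 z.2) ;
  pb_shear :
    let shear (z : prodSpace E G) : prodSpace E E := (z.1, act z.1 z.2) in
    diffeomorphism (prodSpace E G) (image_space shear) (to_image shear) ;
  pb_quot :
    let orb (e e' : E) := exists g, e' = act e g in
    exists phi : X -> quotSpace orb,
      diffeomorphism X (quotSpace orb) phi /\ forall e, phi (pi e) = cls orb e
}.

End principal_bundle.

Section paths.
Context {R : realType}.

Definition unitI : diffSpace R :=
  subSpace (X := realSpace R) [set t : R | 0 <= t <= 1].

Lemma clamp_subproof (t : R) : 0 <= Num.max 0 (Num.min 1 t) <= 1.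
Proof.
by rewrite le_max lexx /= ge_max ler01 ge_min lexx.
Qed.

(* Nearest-point retraction onto [0, 1]: it only serves to give a value in
   [unitI] to expressions such as [2 * t] where they lie in [0, 1]. *)
Definition clamp (t : R) : unitI := 
  exist (fun t : R => 0 <= t <= 1) _ (clamp_subproof t).

Lemma sval_clamp t : 0 <= t <= 1 -> sval (clamp t) = t.
Proof. by case/andP=> t0 t1 /=; rewrite (min_idPr t1) (max_idPr t0). Qed.

Definition i0 : unitI := clamp 0.
Definition i1 : unitI := clamp 1.

Lemma plot_unitI n (U : set 'rV[R]_n) (f : 'rV[R]_n -> R) :
  open U -> smooth_on U f -> (forall u, U u -> 0 <= f u <= 1) ->
  plot unitI U (clamp \o f).
Proof.
move=> oU sf f01; split=> // k; apply: eq_diffn (sf k) => // u.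
by rewrite inE => /f01 /sval_clamp.
Qed.

Section path_space.
Variable X : diffSpace R.

Definition pathSpace : diffSpace R := funSpace unitI X.

Definition ev (a : pathSpace) (t : unitI) : X := sval a t.

Definition sitting (a : pathSpace) : Prop := exists2 e : R, 0 < e &
  forall t : unitI, (sval t < e -> ev a t = ev a i0) /\
                    (1 - e < sval t -> ev a t = ev a i1).

Definition concat (b a : unitI -> X) (t : unitI) : X :=
  if sval t < 2^-1 then a (clamp (2 * sval t)) else b (clamp (2 * sval t - 1)).

Definition reverse (a : unitI -> X) (t : unitI) : X := a (clamp (1 - sval t)).

Lemma smooth_affine n (U : set 'rV[R]_n) (f : 'rV[R]_n -> R) (c d : R) :
  open U -> smooth_on U f -> smooth_on U (fun u => c * f u + d).
Proof.
move=> oU sf k; apply: diffnD => //; last exact: diffn_cst.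
by apply: (@diffnZ _ k _ _ U (fun=> c) f) => //; exact: diffn_cst.
Qed.

Lemma concat_smooth (b a : pathSpace) : sitting b -> sitting a ->
  ev b i0 = ev a i1 -> smooth unitI X (concat (ev b) (ev a)).
Proof.
move=> [e e0 He] [d d0 Hd] ba n U P pP.
have [oU sP] := pP.
pose A := U `&` (fun u => sval (P u) : R) @^-1` [set t | t < 2^-1].
pose B := U `&` (fun u => sval (P u) : R) @^-1` [set t | t > 2^-1].
pose m := Num.min (d / 2) (e / 2).
pose C := U `&` (fun u => sval (P u) : R) @^-1`
  [set t | 2^-1 - m < t /\ t < 2^-1 + m].
have m0 : 0 < m by rewrite lt_min !divr_gt0.
have md : m <= d / 2 by rewrite ge_min lexx.
have me : m <= e / 2 by rewrite ge_min lexx orbT.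
have oA : open A by apply: open_preimage => //; exact: open_lt.
have oB : open B by apply: open_preimage => //; exact: open_gt.
have oC : open C.
  apply: open_preimage => //.
  rewrite (_ : [set _ | _] = [set t | 2^-1 - m < t] `&` [set t | t < 2^-1 + m])//.
  by apply: openI; [exact: open_gt|exact: open_lt].
have P01 u : 0 <= (sval (P u) : R) <= 1 by exact: (svalP (P u)).
have sub (S : set _) : S `<=` U -> smooth_on S (fun u => sval (P u) : R).
  by move=> SU k; apply: diffn_sub (sP k).
have pA : plot X A (concat (ev b) (ev a) \o P).
  apply: (@plot_eq _ _ _ _ (ev a \o (clamp \o (fun u => 2 * sval (P u) + 0)))).
    by move=> u [Uu /= Pu]; rewrite /concat Pu addr0.
  apply: (svalP a); apply: plot_unitI => //.
    by apply: smooth_affine => //; apply: sub => ? [].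
  by move=> u [_ /= Pu]; have := P01 u; lra.
have pB : plot X B (concat (ev b) (ev a) \o P).
  apply: (@plot_eq _ _ _ _ (ev b \o (clamp \o (fun u => 2 * sval (P u) + - 1)))).
    by move=> u [Uu /= Pu]; rewrite /concat ltNge (ltW Pu).
  apply: (svalP b); apply: plot_unitI => //.
    by apply: smooth_affine => //; apply: sub => ? [].
  by move=> u [_ /= Pu]; have := P01 u; lra.
have pC : plot X C (concat (ev b) (ev a) \o P).
  apply: (@plot_eq _ _ _ _ (fun=> ev a i1)); last exact: plot_cst.
  move=> u [Uu /= [Pu1 Pu2]]; rewrite /concat; have := P01 u.
  case: ltP => Pu P01u; apply/esym.
    apply: (Hd _).2; rewrite sval_clamp; lra.
  rewrite -ba; apply: (He _).1; rewrite sval_clamp; lra.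
apply: plot_local => u Uu.
have [Pu|Pu|Pu] := ltgtP (sval (P u) : R) 2^-1.
- by exists A; split=> // ? [].
- by exists B; split=> // ? [].
- by exists C; split=> [|? []|]//; split=> //=; rewrite Pu; lra.
Qed.

Lemma reverse_smooth (a : pathSpace) : smooth unitI X (reverse (ev a)).
Proof.
move=> n U P [oU sP].
have P01 u : 0 <= (sval (P u) : R) <= 1 by exact: (svalP (P u)).
apply: (@plot_eq _ _ _ _ (ev a \o (clamp \o (fun u => - 1 * sval (P u) + 1)))).
  by move=> u _; rewrite /reverse /= mulN1r addrC.
apply: (svalP a); apply: plot_unitI => //; first exact: smooth_affine.
by move=> u _; have := P01 u; lra.
Qed.

(* The concatenation of [b] and [a], first [a] then [b].  It is a smooth path whenever
   [a] and [b] are composable and sitting ([ev_vee]); the default value [a] is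
   never used in that case. *)
Definition vee (b a : pathSpace) : pathSpace :=
  match pselect (smooth unitI X (concat (ev b) (ev a))) with
  | left h => exist _ _ h
  | right _ => a
  end.

Definition rpath (a : pathSpace) : pathSpace := exist _ _ (@reverse_smooth a).

Lemma ev_vee (b a : pathSpace) : sitting b -> sitting a -> ev b i0 = ev a i1 ->
  ev (vee b a) = concat (ev b) (ev a).
Proof.
by move=> sb sa ba; rewrite /vee; case: pselect => // /(_ (concat_smooth sb sa ba)).
Qed.

Lemma cpath_smooth (x : X) : smooth unitI X (fun=> x).
Proof. by move=> n U P /plot_open oU; exact: plot_cst. Qed.

Definition cpath (x : X) : pathSpace := exist _ _ (@cpath_smooth x).

Lemma vee_sitting (b a : pathSpace) : sitting b -> sitting a -> ev b i0 = ev a i1 ->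
  [/\ sitting (vee b a), ev (vee b a) i0 = ev a i0 & ev (vee b a) i1 = ev b i1].
Proof.
move=> sb sa ba; have [e e0 He] := sb; have [d d0 Hd] := sa.
have s0 : sval i0 = 0 :> R by apply: sval_clamp; lra.
have s1 : sval i1 = 1 :> R by apply: sval_clamp; lra.
have E0 : ev (vee b a) i0 = ev a i0.
  rewrite (ev_vee sb sa ba) /concat s0 ifT; last by lra.
  by congr (ev a (clamp _)); lra.
have E1 : ev (vee b a) i1 = ev b i1.
  rewrite (ev_vee sb sa ba) /concat s1 ifF; last by apply/negbTE; lra.
  by congr (ev b (clamp _)); lra.
split=> //; rewrite /sitting E0 E1.
pose m := Num.min (2^-1) (Num.min (d / 2) (e / 2)).
have m0 : 0 < m by rewrite !lt_min !divr_gt0 // invr_gt0 ltr0n.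
have m2 : m <= 2^-1 by rewrite ge_min lexx.
have md : m <= d / 2 by rewrite !ge_min lexx /= orbT.
have me : m <= e / 2 by rewrite !ge_min lexx !orbT.
exists m => // t; rewrite (ev_vee sb sa ba) /concat.
have t01 : 0 <= (sval t : R) <= 1 := svalP t.
split=> tm.
  by rewrite ifT; [apply: (Hd _).1; rewrite sval_clamp; lra|lra].
rewrite ifF; [|by apply/negbTE; lra].
by apply: (He _).2; rewrite sval_clamp; lra.
Qed.

Lemma rpath_sitting (a : pathSpace) : sitting a ->
  [/\ sitting (rpath a), ev (rpath a) i0 = ev a i1 & ev (rpath a) i1 = ev a i0].
Proof.
move=> [e e0 He].
have s0 : sval i0 = 0 :> R by apply: sval_clamp; lra.
have s1 : sval i1 = 1 :> R by apply: sval_clamp; lra.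
have E0 : ev (rpath a) i0 = ev a i1 by rewrite /ev /= /reverse s0 subr0.
have E1 : ev (rpath a) i1 = ev a i0 by rewrite /ev /= /reverse s1 subrr.
split=> //; exists e => // t; rewrite E0 E1.
have t01 : 0 <= (sval t : R) <= 1 := svalP t.
by split=> tm; [apply: (He _).2|apply: (He _).1]; rewrite sval_clamp; lra.
Qed.

Lemma cpath_sitting (x : X) : sitting (cpath x).
Proof. by exists 1. Qed.

Definition reparam (a b : pathSpace) : Prop := exists f : unitI -> unitI,
  [/\ diffeomorphism unitI unitI f, f i0 = i0, f i1 = i1 &
      forall t, ev a t = ev b (f t)].

Definition path_mod : diffSpace R := quotSpace reparam.

(* The bracketing of the fourfold concatenation is immaterial, as [vee] is
   associative up to [reparam]. *)
Definition retrace_step (c d : path_mod) : Prop := exists b h a : pathSpace,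
  [/\ sitting b, sitting h & sitting a] /\
  [/\ ev b i0 = ev a i1, ev h i1 = ev a i1,
      c = cls reparam (vee b a) &
      d = cls reparam (vee b (vee h (vee (rpath h) a)))].

Definition retrace : path_mod -> path_mod -> Prop :=
  clos_refl_sym_trans path_mod retrace_step.

Definition Fspace : diffSpace R := quotSpace retrace.

Definition fclass (a : pathSpace) : Fspace := cls retrace (cls reparam a).

(* Representatives of points of [Fspace] are, by convention, constant near 0 and
   1.  A diffeomorphic reparametrization cannot make a path constant near its
   endpoints, so some points of [Fspace] have no such representative; they
   belong neither to [Fpt] nor to [Omega]. *)
Definition represents (a : pathSpace) (p : Fspace) : Prop :=
  sitting a /\ p = fclass a.

Variable pt : X.

Definition Fpt_set : set Fspace :=
  [set p | exists2 a, represents a p & ev a i0 = pt].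

Definition Omega_set : set Fspace :=
  [set p | exists2 a, represents a p & ev a i0 = pt /\ ev a i1 = pt].

Definition Fpt : diffSpace R := subSpace Fpt_set.

Definition Omega : diffSpace R := subSpace Omega_set.

(* The operations below are computed on chosen representatives; that they do
   not depend on this choice is not used in their definition and has to be
   stated alongside. *)
Definition Frep (p : Fpt) : pathSpace := projT1 (cid2 (svalP p)).

Definition Orep (g : Omega) : pathSpace := projT1 (cid2 (svalP g)).

Lemma FrepP p : represents (Frep p) (sval p) /\ ev (Frep p) i0 = pt.
Proof. by rewrite /Frep; case: cid2. Qed.

Lemma OrepP g : represents (Orep g) (sval g) /\
  (ev (Orep g) i0 = pt /\ ev (Orep g) i1 = pt).
Proof. by rewrite /Orep; case: cid2. Qed.

Definition tau (p : Fpt) : X := ev (Frep p) i1.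

Lemma Fvee_subproof (p : Fpt) (g : Omega) :
  Fpt_set (fclass (vee (Frep p) (Orep g))).
Proof.
have [[sp _] p0] := FrepP p; have [[sg _] [g0 g1]] := OrepP g.
have [||//|s e0 _] := @vee_sitting (Frep p) (Orep g) => //; first by rewrite p0.
by exists (vee (Frep p) (Orep g)) => //; rewrite e0.
Qed.

Definition Fvee (p : Fpt) (g : Omega) : Fpt := exist _ _ (Fvee_subproof p g).

Lemma Omul_subproof (g h : Omega) : Omega_set (fclass (vee (Orep g) (Orep h))).
Proof.
have [[sg _] [g0 g1]] := OrepP g; have [[sh _] [h0 h1]] := OrepP h.
have [||//|s e0 e1] := @vee_sitting (Orep g) (Orep h) => //; first by rewrite g0.
by exists (vee (Orep g) (Orep h)) => //; rewrite e0 e1.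
Qed.

Definition Omul (g h : Omega) : Omega := exist _ _ (Omul_subproof g h).

Lemma Oinv_subproof (g : Omega) : Omega_set (fclass (rpath (Orep g))).
Proof.
have [[sg _] [g0 g1]] := OrepP g; have [s e0 e1] := rpath_sitting sg.
by exists (rpath (Orep g)) => //; rewrite e0 e1.
Qed.

Definition Oinv (g : Omega) : Omega := exist _ _ (Oinv_subproof g).

Lemma Oone_subproof : Omega_set (fclass (cpath pt)).
Proof. by exists (cpath pt) => //; split=> //; exact: cpath_sitting. Qed.

Definition Oone : Omega := exist _ _ Oone_subproof.

End path_space.
End paths.
Arguments unitI R : clear implicits.

(* Main.v *)
Require Import Defs.
From mathcomp Require Import all_boot all_order all_algebra.
From mathcomp Require Import all_classical reals topology normedtype derive.
From mathcomp Require Import sequences realfun exp.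
From mathcomp Require Import ring lra.
From Stdlib Require Import Relation_Operators.

(** A diffeomorphism of [0, 1] that reparametrizes a path may be altered freely
    where the path is constant.  Hence two paths are [reparam]-equivalent as
    soon as they correspond under a strictly increasing map of [0, 1] that is a
    local diffeomorphism except at finitely many points around which the target
    path is constant: near each such point the map is blended with a line of
    small slope.  This gives the associativity and unit laws for paths constant
    near their ends, their compatibility with [reparam], and, by induction on
    retrace steps, the group and action laws on [Omega] and [Fpt].

    A plot of [Fpt] lifts locally to a plot of paths, each constant near 0 and
    1, but on intervals that may shrink as the parameter varies.  Precomposing
    with one fixed flat function makes these intervals uniform and does not
    change the classes, so that concatenation becomes smooth.  Local lifts of a
    plot [P] of [X] along [tau] are obtained by following a fixed path from the
    base point to [P u] and then [P] along the segment from [u] to [v]. *)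

Set Implicit Arguments.
Unset Strict Implicit.
Unset Printing Implicit Defensive.

Import Order.TTheory GRing.Theory Num.Theory.
Import numFieldNormedType.Exports.

Local Open Scope classical_set_scope.
Local Open Scope ring_scope.

(** * Smooth functions of a real variable and a smooth step *)

Section real_calculus.
Context {R : realType}.
Implicit Types V W : normedModType R.

Lemma derive_real W (f : R -> W) x v : differentiable f x ->
  'D_v f x = v *: 'D_1 f x.
Proof.
by move=> df; rewrite !deriveE// -{1}[v]mulr1 -[v * 1]/(v *: (1 : R)) linearZ.
Qed.

Lemma diffn_is_derive k (U : set R) (f d : R -> R) : open U ->
  (forall x, U x -> is_derive x 1 f (d x)) -> diffn k U d -> diffn k.+1 U f.
Proof.
move=> oU fd dd; have df x : U x -> differentiable f x.
  by move=> Ux; apply/derivable1_diffP; have [] := fd x Ux.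
split=> // v; apply: (@eq_diffn _ _ _ _ _ (fun x => v *: d x)) => //.
  move=> x; rewrite inE => Ux; rewrite (derive_real v (df x Ux)).
  by have [_ ->] := fd x Ux.
by apply: (@diffnZ _ k _ _ U (fun=> v) d) => //; exact: diffn_cst.
Qed.

(** [diffn_comp] passes through row vectors. Here the middle space is [R] itself, where 1 is the
    only direction needed, so the sum over coordinates in the chain rule has a single term. *)
Lemma diffn_compR k V W (U : set V) (U' : set R) (f : V -> R) (g : R -> W) :
  open U -> (forall x, U x -> U' (f x)) -> diffn k U f -> diffn k U' g ->
  diffn k U (g \o f).
Proof.
move=> oU UU'; elim: k f g UU' => // k IH f g UU' Hf Hg.
have [df Df] := Hf; have [dg Dg] := Hg.
have dgf x : U x -> differentiable (g \o f) x.
  by move=> Ux; apply: differentiable_comp; [exact: df|apply: dg; exact: UU'].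
split=> [//|v].
apply: (@eq_diffn _ _ _ _ _ (fun x => 'D_v f x *: ('D_1 g \o f) x)) => //.
  move=> x; rewrite inE => Ux.
  have dgfx := dg _ (UU' _ Ux); have dfx := df _ Ux.
  rewrite [RHS]deriveE; last exact: dgf.
  rewrite (diff_comp dfx dgfx) /= -deriveE // -deriveE //.
  by rewrite [RHS]derive_real.
apply: diffnZ => //; first exact: Df.
by apply: IH => //; [exact: diffnW Hf|exact: Dg].
Qed.

Lemma smooth_on_compR V W (U : set V) (U' : set R) (f : V -> R) (g : R -> W) :
  open U -> (forall x, U x -> U' (f x)) -> smooth_on U f -> smooth_on U' g ->
  smooth_on U (g \o f).
Proof. by move=> oU UU' sf sg k; apply: diffn_compR UU' (sf k) (sg k). Qed.

Lemma diffn_inv k (U : set R) : open U -> (forall x, U x -> x != 0) ->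
  diffn k U (fun x : R => x^-1).
Proof.
move=> oU U0; elim: k => // k IH.
apply: (@diffn_is_derive _ _ _ (fun x => - 1 *: (x^-1 *: x^-1))) => //.
  move=> x /U0 x0; apply: is_derive_eq; first exact: (@is_deriveV _ id).
  by rewrite /= /GRing.scale/= mulr1 mulN1r -exprVn expr2.
apply: (@diffnZ _ k _ _ U (fun=> -1)) => //; first exact: diffn_cst.
exact: diffnZ.
Qed.

Lemma smooth_onD V W (U : set V) (f g : V -> W) : open U ->
  smooth_on U f -> smooth_on U g -> smooth_on U (fun x => f x + g x).
Proof. by move=> oU sf sg k; apply: diffnD. Qed.

Lemma smooth_onM V (U : set V) (f g : V -> R) : open U ->
  smooth_on U f -> smooth_on U g -> smooth_on U (fun x => f x * g x).
Proof. by move=> oU sf sg k; apply: (@diffnZ _ k _ _ U f g). Qed.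

Lemma smooth_on_cst V W (U : set V) (c : W) : smooth_on U (fun=> c).
Proof. by move=> k; exact: diffn_cst. Qed.

Lemma smooth_on_sub V W (U U' : set V) (f : V -> W) :
  U' `<=` U -> smooth_on U f -> smooth_on U' f.
Proof. by move=> UU sf k; apply: diffn_sub (sf k). Qed.

Lemma eq_smooth_on V W (U : set V) (f g : V -> W) : open U ->
  (forall x, U x -> f x = g x) -> smooth_on U f -> smooth_on U g.
Proof. by move=> oU fg sf k; apply: eq_diffn (sf k) => // x; rewrite inE => /fg. Qed.

Lemma smooth_on_is_derive (U : set R) (f : R -> R) x :
  smooth_on U f -> U x -> is_derive x 1 f ('D_1 f x).
Proof.
by move=> /(_ 1%N) [df _] /df dfx; apply/derivableP/derivable1_diffP.
Qed.

Lemma smooth_on_derive V W (U : set V) (f : V -> W) v :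
  smooth_on U f -> smooth_on U ('D_v f).
Proof. by move=> sf k; have [_] := sf k.+1; exact. Qed.

(** The index makes the family stable under differentiation: the derivative of [flat n] is a linear
    combination of [flat n.+2] and [flat n.+1]. The classical flat function is [flat 0]. *)
Definition flat (n : nat) (x : R) : R :=
  if 0 < x then x^-1 ^+ n * expR (- x^-1) else 0.

Lemma flat_ge0 n x : 0 <= flat n x.
Proof.
rewrite /flat; case: ltP => // x0.
by rewrite mulr_ge0 ?expR_ge0// exprn_ge0// invr_ge0 ltW.
Qed.

(** With [y = x^-1], this is the bound of [expR y] from below by the term of degree [n.+1] of its
    series. It yields continuity at 0. *)
Lemma flat_le n x : flat n x <= (n.+1)`!%:R * `|x|.
Proof.
rewrite /flat; case: ltP => x0; last by rewrite mulr_ge0.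
rewrite expRN ler_pdivrMr ?expR_gt0// (gtr0_norm x0).
have y0 : 0 < x^-1 by rewrite invr_gt0.
have : x^-1 ^+ n.+1 / (n.+1)`!%:R <= expR x^-1.
  by apply: le_trans (expR_ge1Dxn n (ltW y0)); rewrite lerDr.
rewrite ler_pdivrMr ?ltr0n ?fact_gt0// => H.
rewrite -(ler_pM2r y0) -exprSr (le_trans H)//.
rewrite le_eqVlt; apply/orP; left; apply/eqP; field; exact: lt0r_neq0.
Qed.

Lemma flat_continuous0 n : {for 0, continuous (flat n)}.
Proof.
have f0 : 0 < (n.+1)`!%:R :> R by rewrite ltr0n fact_gt0.
apply/cvgrPdist_lt => e e0.
have H : \forall x \near (0 : R), `|x| < e / (n.+1)`!%:R.
  by apply: nbhs0_lt; rewrite divr_gt0.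
near=> x.
rewrite {1}/flat ltxx sub0r normrN ger0_norm ?flat_ge0//.
apply: le_lt_trans (flat_le n x) _.
rewrite mulrC -ltr_pdivlMr//.
by near: x; exact: H.
Unshelve. all: by end_near. Qed.

Lemma flat_is_derive n (x : R) :
  is_derive x 1 (flat n) (flat n.+2 x - n%:R * flat n.+1 x).
Proof.
have [x0|x0|->] := ltgtP x 0.
- apply: (@near_eq_is_derive _ _ _ (fun=> 0)).
    near=> y; rewrite /flat ltNge ifF//; apply/negbTE; rewrite negbK ltW//.
    by near: y; exact: lt_nbhsl.
  by rewrite /flat !ltNge !(ltW x0)/= mulr0 subrr; exact: is_derive_cst.
- apply: (@near_eq_is_derive _ _ _ (fun y : R => y^-1 ^+ n * expR (- y^-1))).
    near=> y; rewrite /flat ifT//.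
    by near: y; exact: lt_nbhsr.
  have xn0 : x != 0 by rewrite gt_eqF.
  have dV : is_derive x 1 (fun y : R => y^-1) (- x ^- 2).
    by apply: is_derive_eq; [exact: (@is_deriveV _ id)|rewrite /= /GRing.scale/= mulr1].
  have dE : is_derive x 1 (expR \o (fun y : R => - y^-1))
      (expR (- x^-1) * x ^- 2).
    apply: is_derive1_comp; apply: is_derive_eq; rewrite ?opprK//.
  have dX : is_derive x 1 (fun y : R => y^-1 ^+ n)
      ((n%:R * x^-1 ^+ n.-1) *: - x ^- 2).
    by have := is_deriveX n dV; rewrite exprfctE.
  have dM := is_deriveM dX dE; rewrite mulrfctE in dM.
  apply: is_derive_eq.
  rewrite /flat x0 /= /GRing.scale/= {dX dM}.
  by case: n => [|n]/=; rewrite ?mul0r ?exprS; field.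
(* At 0 the difference quotient of [flat n] is [flat n.+1], which is continuous there with value
   0. *)
apply/is_derive1_caratheodory; exists (flat n.+1); split.
- move=> z; rewrite /flat ltxx !subr0; case: ltP => z0; last by rewrite mul0r.
  by rewrite exprS; field; rewrite gt_eqF.
- exact: flat_continuous0.
- by rewrite /flat ltxx mulr0 subr0.
Unshelve. all: by end_near. Qed.

Lemma flat_smooth n (U : set R) : open U -> smooth_on U (flat n).
Proof.
move=> oU k; elim: k n => // k IH n.
apply: (diffn_is_derive oU (fun x _ => flat_is_derive n x)).
apply: (@eq_diffn _ _ _ _ _ (fun x => flat n.+2 x + (- n%:R) *: flat n.+1 x)) => //.
  by move=> x _; rewrite /GRing.scale/= mulNr.
apply: diffnD => //; apply: (@diffnZ _ k _ _ U (fun=> - n%:R)) => //.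
exact: diffn_cst.
Qed.

(** The usual smooth transition from 0 to 1. The denominator never vanishes because [x] and [1 - x]
    cannot both be nonpositive. *)
Definition step (x : R) : R := flat 0 x / (flat 0 x + flat 0 (1 - x)).

Lemma flat0_gt0 x : 0 < x -> 0 < flat 0 x.
Proof. by move=> x0; rewrite /flat x0 expr0 mul1r expR_gt0. Qed.

Lemma flat_le0 n x : x <= 0 -> flat n x = 0.
Proof. by rewrite /flat leNgt => /negbTE ->. Qed.

Lemma step_denom_gt0 x : 0 < flat 0 x + flat 0 (1 - x).
Proof.
have [x0|x0] := ltP 0 x; first by rewrite ltr_pwDl ?flat0_gt0 ?flat_ge0.
by rewrite ltr_wpDl ?flat_ge0// flat0_gt0//; lra.
Qed.

Lemma step_le0 x : x <= 0 -> step x = 0.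
Proof. by move=> x0; rewrite /step flat_le0// mul0r. Qed.

Lemma step_ge1 x : 1 <= x -> step x = 1.
Proof.
move=> x1; rewrite /step (@flat_le0 _ (1 - x)) ?addr0 ?divff//; last by lra.
by rewrite gt_eqF// flat0_gt0//; lra.
Qed.

Lemma step_ge0 x : 0 <= step x.
Proof. by rewrite /step divr_ge0 ?flat_ge0// ltW// step_denom_gt0. Qed.

Lemma step_le1 x : step x <= 1.
Proof.
by rewrite /step ler_pdivrMr ?step_denom_gt0// mul1r lerDl flat_ge0.
Qed.

Lemma step_smooth (U : set R) : open U -> smooth_on U step.
Proof.
move=> oU; apply: (@smooth_onM _ U (flat 0) (GRing.inv \o
    (fun x => flat 0 x + flat 0 (1 - x)))) => //; first exact: flat_smooth.
have o0 : open [set x : R | 0 < x] by exact: open_gt.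
apply: (@smooth_on_compR _ _ _ [set x : R | 0 < x]) => //.
- by move=> x _; exact: step_denom_gt0.
- apply: smooth_onD => //; first exact: flat_smooth.
  apply: (@smooth_on_compR _ _ U setT (fun x : R => 1 - x) (flat 0)) => //; last first.
    exact: (flat_smooth _ openT).
  apply: (@eq_smooth_on _ _ _ (fun x : R => 1 + (-1) * x)) => //.
    by move=> x _; rewrite mulN1r.
  apply: smooth_onD => //; first exact: smooth_on_cst.
  by apply: smooth_onM => //; [exact: smooth_on_cst|exact: smooth_on_id].
- by move=> k; apply: diffn_inv => // x /=; exact: lt0r_neq0.
Qed.

Lemma step_is_derive (x : R) : is_derive x 1 step
  ((flat 2 x * flat 0 (1 - x) + flat 0 x * flat 2 (1 - x))
    / (flat 0 x + flat 0 (1 - x)) ^+ 2).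
Proof.
have D0 := lt0r_neq0 (step_denom_gt0 x).
have d1 : is_derive x 1 (flat 0) (flat 2 x).
  by apply: is_derive_eq; [exact: flat_is_derive|rewrite mul0r subr0].
have d2 : is_derive x 1 (flat 0 \o (fun y => 1 - y)) (- flat 2 (1 - x)).
  have d0 : is_derive x 1 (fun y : R => 1 - y) (-1).
    by apply: is_derive_eq; rewrite add0r mul1r.
  apply: is_derive_eq.
    by apply: is_derive1_comp; first exact: flat_is_derive.
  by rewrite mul0r subr0 mulrN1.
have d3 := @is_deriveV _ (fun y => flat 0 y + flat 0 (1 - y)) _ _ _ D0
  (is_deriveD d1 d2).
have dM := is_deriveM d1 d3; rewrite mulrfctE in dM.
apply: is_derive_eq.
by rewrite /GRing.scale/=; field.
Qed.

Lemma step_derive_ge0 x : 0 <= 'D_1 step x.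
Proof.
have [_ ->] := step_is_derive x.
by rewrite divr_ge0 ?exprn_ge0 ?addr_ge0 ?mulr_ge0 ?flat_ge0.
Qed.

Lemma step_derive_gt0 x : 0 < x < 1 -> 0 < 'D_1 step x.
Proof.
move=> /andP[x0 x1]; have [_ ->] := step_is_derive x.
rewrite divr_gt0 ?exprn_gt0 ?step_denom_gt0// ltr_pwDl//.
  rewrite mulr_gt0 ?flat0_gt0 ?subr_gt0// /flat x0 mulr_gt0 ?expR_gt0//.
  by rewrite exprn_gt0// invr_gt0.
by rewrite mulr_ge0 ?flat_ge0.
Qed.

Lemma step_derive_out x : ~~ (0 <= x <= 1) -> 'D_1 step x = 0.
Proof.
move=> x01; have [_ ->] := step_is_derive x.
have [x0|x0] := ltP x 0; first by rewrite !(@flat_le0 _ x) ?ltW// !mul0r addr0 mul0r.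
have x1 : 1 - x <= 0 by move: x01; rewrite x0 /=; lra.
by rewrite !(@flat_le0 _ (1 - x))// !mulr0 addr0 mul0r.
Qed.

(** Positivity is asked only in the interior so that the statement applies to [step] on [0, 1],
    whose derivative vanishes at both ends. *)
Lemma itv_derive_lt (f : R -> R) x y : x < y ->
  (forall t, x <= t <= y -> derivable f t 1) ->
  (forall t, x < t < y -> 0 < 'D_1 f t) -> f x < f y.
Proof.
move=> xy df f0.
have [|t|t txy ft] := @MVT R f ('D_1 f) x y xy.
- by move=> t; rewrite in_itv/= => txy; apply/derivableP/df; lra.
- apply/continuous_in_subspaceT : t => t; rewrite inE/= in_itv/= => txy.
  by apply/differentiable_continuous/derivable1_diffP/df.
rewrite -subr_gt0 ft mulr_gt0 ?subr_gt0//; apply: f0.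
by move: txy; rewrite in_itv.
Qed.

Lemma step_lt x y : 0 <= x -> x < y -> y <= 1 -> step x < step y.
Proof.
move=> x0 xy y1; apply: itv_derive_lt => // t txy.
  by have [] := step_is_derive t.
by apply: step_derive_gt0; lra.
Qed.

Lemma step_le x y : x <= y -> step x <= step y.
Proof.
rewrite le_eqVlt => /predU1P[->//|xy].
have [x0|x0] := leP x 0; first by rewrite (step_le0 x0) step_ge0.
have [y1|y1] := leP 1 y; first by rewrite (step_ge1 y1) step_le1.
by apply/ltW/step_lt => //; exact: ltW.
Qed.

Lemma step_surj y : 0 <= y <= 1 -> exists2 x, 0 <= x <= 1 & step x = y.
Proof.
move=> y01; have [||x x01 <-] := @IVT R step 0 1 y ler01.
- apply/continuous_subspaceT => x.
  by have [/derivable1_diffP/differentiable_continuous] := step_is_derive x.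
- by rewrite step_le0// step_ge1// (min_idPl ler01) (max_idPr ler01).
- by exists x => //; move: x01; rewrite in_itv.
Qed.

End real_calculus.

(** * Regular maps of the line *)

Section regular.
Context {R : realType}.
Implicit Types (f g l : R -> R) (U : set R).

Lemma open_preimage_on (V W : normedModType R) (U : set V) (A : set W)
    (f : V -> W) :
  open U -> smooth_on U f -> open A -> open (U `&` f @^-1` A).
Proof.
move=> oU sf oA; rewrite openE => u [Uu Au].
rewrite /interior; apply: filterI; first exact: open_nbhs_nbhs.
apply: (smooth_on_continuous sf Uu); exact: open_nbhs_nbhs.
Qed.

(** An increasing local diffeomorphism at [t]. The condition is local so that a piecewise map can
    satisfy it away from its breakpoints; holding everywhere, it gives a diffeomorphism onto an open
    image. *)
Definition regular f t := exists U,
  [/\ open U, U t, smooth_on U f & forall x, U x -> 0 < 'D_1 f x].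

Lemma eq_regular U f g t : open U -> U t -> (forall x, U x -> f x = g x) ->
  regular f t -> regular g t.
Proof.
move=> oU Ut fg [U' [oU' U't sf f0]]; exists (U `&` U'); split=> //.
- exact: openI.
- apply: (@eq_smooth_on _ _ _ _ f); first exact: openI.
    by move=> x [/fg].
  by apply: smooth_on_sub sf => x [].
- move=> x [Ux U'x]; rewrite -(_ : 'D_1 f x = 'D_1 g x) ?f0//.
  apply: near_eq_derive; apply: (@open_near_eq _ _ _ U) => // y; rewrite inE.
  exact: fg.
Qed.

Lemma regular_comp f g t : regular f t -> regular g (f t) ->
  regular (fun x => g (f x)) t.
Proof.
move=> [U [oU Ut sf f0]] [U' [oU' U't sg g0]].
have oI := open_preimage_on oU sf oU'.
have sfI : smooth_on (U `&` f @^-1` U') f by apply: smooth_on_sub sf => x [].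
exists (U `&` f @^-1` U'); split=> //.
- by apply: (smooth_on_compR oI _ sfI sg) => x [].
- move=> x Ix; have [Ux U'x] := Ix.
  have [_ ->] := is_derive1_comp (smooth_on_is_derive sg U'x)
    (smooth_on_is_derive sf Ux).
  by rewrite mulr_gt0 ?g0 ?f0.
Qed.

Lemma regular_affine (c d t : R) : 0 < c -> regular (fun x => c * x + d) t.
Proof.
move=> c0; exists setT; split=> //; first exact: openT.
  apply: smooth_onD; [exact: openT| |exact: smooth_on_cst].
  apply: smooth_onM; [exact: openT|exact: smooth_on_cst|exact: smooth_on_id].
move=> x _; suff [_ ->//] : is_derive x 1 (fun x => c * x + d) c.
by apply: is_derive_eq; rewrite /GRing.scale/=; ring.
Qed.

Lemma regular_id (t : R) : regular id t.
Proof.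
apply: (@eq_regular setT (fun x => 1 * x + 0)) => //; first exact: openT.
  by move=> x _; rewrite mul1r addr0.
exact: regular_affine.
Qed.

Lemma regular_smooth f : (forall t, regular f t) -> smooth_on setT f.
Proof.
move=> rf k; apply: diffn_local => t _.
by have [U [_ Ut sf _]] := rf t; exists U => //; exact: sf.
Qed.

Lemma regular_derive_gt0 f t : regular f t -> 0 < 'D_1 f t.
Proof. by move=> [U [_ Ut _]]; exact. Qed.

Lemma regular_derivable f t : regular f t -> derivable f t 1.
Proof. by move=> [U [_ Ut sf _]]; have [] := smooth_on_is_derive sf Ut. Qed.

Lemma regular_lt f : (forall t, regular f t) -> {homo f : x y / x < y}.
Proof.
move=> rf x y xy; apply: itv_derive_lt => // t _.
  exact: regular_derivable.
exact: regular_derive_gt0.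
Qed.

Definition blend (a b : R) f l (x : R) : R :=
  f x + step ((x - a) / (b - a)) * (l x - f x).

Lemma blend_le a b f l x : a < b -> x <= a -> blend a b f l x = f x.
Proof.
move=> ab xa; rewrite /blend step_le0 ?mul0r ?addr0//.
by rewrite ler_pdivrMr ?mul0r; lra.
Qed.

Lemma blend_ge a b f l x : a < b -> b <= x -> blend a b f l x = l x.
Proof.
move=> ab xa; rewrite /blend step_ge1 ?mul1r ?[f x + _]addrC ?subrK//.
by rewrite ler_pdivlMr ?mul1r; lra.
Qed.

(** With weight [s], the increment from [x] to [y] is [(1 - s y) * (f y - f x) + s y * (l y - l x) +
    (s y - s x) * (l x - f x)]. The last term is nonnegative where the weight varies, since [f <= l]
    there, and one of the first two is positive according to whether [s y] exceeds 1/2. *)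
Lemma blend_lt a b f l : a < b ->
  {homo f : x y / x < y} -> {homo l : x y / x < y} ->
  (forall x, a <= x <= b -> f x <= l x) -> {homo blend a b f l : x y / x < y}.
Proof.
move=> ab hf hl fl x y xy; have hfxy := hf _ _ xy; have hlxy := hl _ _ xy.
have ba : 0 < b - a by lra.
pose s z := step ((z - a) / (b - a)).
have s0 z : 0 <= s z by exact: step_ge0.
have s1 z : s z <= 1 by exact: step_le1.
have sxy : s x <= s y.
  by apply: step_le; rewrite ler_pM2r ?invr_gt0//; lra.
have [xa|ax] := ltP x a; last first.
  have H : 0 <= (s y - s x) * (l x - f x).
    have [xb|bx] := leP x b; first by rewrite mulr_ge0 ?subr_ge0// fl ?ax.
    have step1 z : b < z -> s z = 1.
      by move=> bz; apply: step_ge1; rewrite ler_pdivlMr//; lra.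
    by rewrite !step1 ?subrr ?mul0r//; lra.
  have [sy0|sy0] := leP (s y) 2^-1.
    have : 0 < (1 - s y) * (f y - f x) by rewrite mulr_gt0//; lra.
    have : 0 <= s y * (l y - l x) by rewrite mulr_ge0//; lra.
    by rewrite /blend -/(s x) -/(s y); lra.
  have : 0 <= (1 - s y) * (f y - f x) by rewrite mulr_ge0//; [have := s1 y; lra|lra].
  have : 0 < s y * (l y - l x) by rewrite mulr_gt0//; lra.
  by rewrite /blend -/(s x) -/(s y); lra.
rewrite blend_le//; last exact: ltW.
have [ya|ay] := leP y a; first by rewrite blend_le.
have [yb|yb] := leP b y.
  rewrite blend_ge//; have := hf _ _ xa; have := fl a.
  have := hl _ _ ay; rewrite lexx (ltW ab) => ? /(_ isT) ? ?; lra.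
have : 0 <= s y * (l y - f y) by rewrite mulr_ge0// subr_ge0 fl// (ltW ay) ltW.
by rewrite /blend -/(s y); lra.
Qed.

(** The infinitesimal form of the decomposition behind [blend_lt]: the term containing the
    derivative of [step] is nonnegative on [[a, b]] and vanishes elsewhere. *)
Lemma blend_regular a b f l t : a < b ->
  (forall x, a <= x <= b -> f x <= l x) ->
  regular f t -> regular l t -> regular (blend a b f l) t.
Proof.
move=> ab fl [U [oU Ut sf f0]] [U' [oU' U't sl l0]].
have oI : open (U `&` U') by exact: openI.
have sfI : smooth_on (U `&` U') f by apply: smooth_on_sub sf => x [].
have slI : smooth_on (U `&` U') l by apply: smooth_on_sub sl => x [].
have ba : 0 < b - a by lra.
exists (U `&` U'); split=> //.
  apply: smooth_onD => //; apply: smooth_onM => //.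
    apply: (@smooth_on_compR _ _ _ _ setT (fun x => (x - a) / (b - a)) step) => //.
      apply: smooth_onM => //; last exact: smooth_on_cst.
      by apply: smooth_onD => //; [exact: smooth_on_id|exact: smooth_on_cst].
    by apply: step_smooth; exact: openT.
  apply: smooth_onD => //; apply: (@eq_smooth_on _ _ _ _ (fun x => (-1) * f x)) => //.
    by move=> x _; rewrite mulN1r.
  by apply: smooth_onM => //; exact: smooth_on_cst.
move=> x Ix; have df := smooth_on_is_derive sfI Ix.
have dl := smooth_on_is_derive slI Ix.
have da : is_derive x 1 (fun x => (x - a) / (b - a)) (b - a)^-1.
  by apply: is_derive_eq; rewrite /GRing.scale/=; lra.
set u := (x - a) / (b - a).
have ds0 : is_derive u 1 step ('D_1 step u).
  by apply/derivableP; have [] := step_is_derive u.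
have ds := @is_derive1_comp _ step (fun x => (x - a) / (b - a)) x _ _ ds0 da.
have dM := is_deriveD df (is_deriveM ds (is_deriveB dl df)).
rewrite [X in 0 < X](_ : _ = (1 - step u) * 'D_1 f x + step u * 'D_1 l x
   + 'D_1 step u / (b - a) * (l x - f x)); last first.
  rewrite -[LHS]/('D_1 (f + (step \o (fun x => (x - a) / (b - a))) * (l - f)) x).
  have [_ ->] := dM; rewrite /GRing.scale/= -/u !fctE; ring.
have [Ux U'x] := Ix.
have s0 := step_ge0 u; have s1 := step_le1 u.
rewrite ltr_pwDl//.
  have l1 := l0 _ U'x; have f1 := f0 _ Ux.
  have [su|su] := leP (step u) 2^-1.
    have : 0 < (1 - step u) * 'D_1 f x by apply: mulr_gt0 => //; lra.
    by have : 0 <= step u * 'D_1 l x; [exact: mulr_ge0 (ltW l1)|lra].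
  have : 0 < step u * 'D_1 l x by apply: mulr_gt0 => //; lra.
  have : 0 <= (1 - step u) * 'D_1 f x by apply: mulr_ge0 (ltW f1); lra.
  by lra.
have [u01|u01] := boolP (0 <= u <= 1); last by rewrite step_derive_out// !mul0r.
rewrite mulr_ge0 ?divr_ge0 ?step_derive_ge0 ?(ltW ba)// subr_ge0 fl//.
by move: u01; rewrite /u ler_pdivrMr// ler_pdivlMr//; lra.
Qed.

(* Near [s], replace [f] by a line through [(s, f s)] whose slope is so small
   that it lies above [f] to the left of [s] and below [f] to the right. *)
Lemma regularize f s r : {homo f : x y / x < y} -> 0 < r -> exists g,
  [/\ {homo g : x y / x < y}, forall t, r <= `|t - s| -> g t = f t, g s = f s,
      regular g s & forall t, regular f t -> regular g t].
Proof.
move=> hf r0; pose k := Num.min ((f s - f (s - r / 2)) / r)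
  ((f (s + r / 2) - f s) / r).
have fl : f (s - r / 2) < f s by apply: hf; lra.
have fr : f s < f (s + r / 2) by apply: hf; lra.
have k0 : 0 < k by rewrite lt_min !divr_gt0// subr_gt0.
have kl : k * r <= f s - f (s - r / 2) by rewrite -ler_pdivlMr// ge_min lexx.
have kr : k * r <= f (s + r / 2) - f s.
  by rewrite -ler_pdivlMr// ge_min lexx orbT.
have hfle x y : x <= y -> f x <= f y.
  by rewrite le_eqVlt => /predU1P[->//|/hf/ltW].
pose L x := k * x + (f s - k * s).
have hL : {homo L : x y / x < y}.
  by move=> x y xy; rewrite /L ltrD2r ltr_pM2l.
have fL x : s - r <= x <= s - r / 2 -> f x <= L x.
  move=> xs; have /hfle : x <= s - r / 2 by lra.
  have : k * (s - x) <= k * r by rewrite ler_pM2l//; lra.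
  by rewrite /L; lra.
have ab : s - r < s - r / 2 by lra.
have cd : s + r / 2 < s + r by lra.
pose h := blend (s - r) (s - r / 2) f L.
have hh : {homo h : x y / x < y} by exact: blend_lt.
have rh t : regular f t -> regular h t.
  by move=> rf; apply: blend_regular => //; exact: regular_affine.
have hE x : s - r / 2 <= x -> h x = L x by exact: blend_ge.
have hf' x : s + r / 2 <= x <= s + r -> h x <= f x.
  move=> xs; rewrite hE; last by lra.
  have /hfle : s + r / 2 <= x by lra.
  have : k * (x - s) <= k * r by rewrite ler_pM2l//; lra.
  by rewrite /L; lra.
(* The first blend goes from [f] to the line on the left of [s], the second returns from the line to
   [f] on the right. *)
exists (blend (s + r / 2) (s + r) h f); split.
- exact: blend_lt.
- move=> t; rewrite ler_normr => /orP[rt|rt].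
    by rewrite blend_ge//; lra.
  by rewrite blend_le// /h ?blend_le//; lra.
- by rewrite blend_le ?hE /L//; lra.
- apply: (@eq_regular [set x | s - r / 2 < x < s + r / 2] L); last first.
  + exact: regular_affine.
  + by move=> x /= xs; rewrite blend_le ?hE//; lra.
  + by move=> /=; lra.
  + rewrite (_ : [set _ | _] = [set x | s - r / 2 < x] `&` [set x | x < s + r / 2]).
      by apply: openI; [exact: open_gt|exact: open_lt].
    by apply/seteqP; split=> x /=; [move/andP|move=> [? ?]; apply/andP].
- by move=> t rf; apply: blend_regular => //; exact: rh.
Qed.

(** The intermediate value theorem makes the range open; it may be a proper subset of the line. The
    derivative of [g] is the inverse of ['D_1 f \o g], so [k] derivatives of [g] give one more. *)
Lemma inverse_smooth f g : (forall t, regular f t) -> cancel f g ->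
  open (range f) /\ smooth_on (range f) g.
Proof.
move=> rf fK; have hf := regular_lt rf; have sf := regular_smooth rf.
have cf : continuous f by move=> x; exact: (smooth_on_continuous sf).
have of_ : open (range f).
  rewrite openE => _ [x _ <-]; rewrite /interior.
  have fl : f (x - 1) < f x by apply: hf; lra.
  have fr : f x < f (x + 1) by apply: hf; lra.
  near=> y.
  have [|||z _ <-] := @IVT R f (x - 1) (x + 1) y; last by exists z.
  - by lra.
  - exact: continuous_subspaceT.
  - have fly : f (x - 1) < y by near: y; exact: lt_nbhsr.
    have fry : y < f (x + 1) by near: y; exact: lt_nbhsl.
    rewrite (min_idPl (ltW (lt_trans fl fr))) (max_idPr (ltW (lt_trans fl fr))).
    by rewrite !ltW.
split=> // k; elim: k => // k IH.
apply: (@diffn_is_derive _ _ _ _ (GRing.inv \o ('D_1 f \o g))) => //.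
  move=> _ [x _ <-] /=; rewrite fK.
  apply: is_derive_inverse => //.
  - by near=> y; exact: fK.
  - by near=> y; exact: cf.
  - by apply/derivableP; exact: regular_derivable.
  - by rewrite gt_eqF//; exact: regular_derive_gt0.
have o0 : open [set x : R | 0 < x] by exact: open_gt.
apply: (@diffn_compR _ _ _ _ _ [set x : R | 0 < x]) => //.
- by move=> y _; exact: regular_derive_gt0.
- apply: (@diffn_compR _ _ _ _ _ setT) => //.
  exact: (smooth_on_derive (1 : R) sf k).
- by apply: diffn_inv => // x /=; exact: lt0r_neq0.
Unshelve. all: by end_near. Qed.

End regular.

(** * Diffeomorphisms of the unit interval *)

(* [lra] fails on hypotheses that equate points of a diffeological space. *)
Ltac rlra :=
  repeat match goal with H : @eq (carrier _) _ _ |- _ => clear H end; lra.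

Section unit_interval.
Context {R : realType}.

Lemma sval_inj T (P : T -> Prop) : injective (@sval T P).
Proof. by move=> [x Px] [y Py] /= xy; exact: eq_exist. Qed.

Lemma sval_i0 : sval (@i0 R) = 0.
Proof. by apply: sval_clamp; lra. Qed.

Lemma sval_i1 : sval (@i1 R) = 1.
Proof. by apply: sval_clamp; lra. Qed.

Lemma clampK (t : unitI R) : clamp (sval t) = t.
Proof. by apply: sval_inj; rewrite sval_clamp//; exact: (svalP t). Qed.

Lemma clamp_le0 (t : R) : t <= 0 -> clamp t = i0.
Proof.
move=> t0; apply: sval_inj; rewrite sval_i0/=.
by rewrite min_r ?max_l//; lra.
Qed.

Lemma clamp_ge1 (t : R) : 1 <= t -> clamp t = i1.
Proof.
move=> t1; apply: sval_inj; rewrite sval_i1/=.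
by rewrite min_l ?max_r//; lra.
Qed.

Lemma unitI01 (t : unitI R) : 0 <= (sval t : R) <= 1.
Proof. exact: (svalP t). Qed.

Lemma open_lt_lt (a b : R) : open [set x : R | a < x < b].
Proof.
rewrite (_ : [set _ | _] = [set x | a < x] `&` [set x | x < b]).
  by apply: openI; [exact: open_gt|exact: open_lt].
by apply/seteqP; split=> x /=; [move/andP|move=> [? ?]; apply/andP].
Qed.

Lemma diffeomorphism_regular (f : R -> R) :
  (forall t, regular f t) -> f 0 = 0 -> f 1 = 1 ->
  diffeomorphism (unitI R) (unitI R) (fun t => clamp (f (sval t))).
Proof.
move=> rf f0 f1; have hf := regular_lt rf; have sf := regular_smooth rf.
have mf := le_mono hf.
(* The default 0 is taken only outside the range of [f], which contains [0, 1] by the intermediate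
   value theorem. *)
pose g y := xget 0 [set x | f x = y].
have fK : cancel f g.
  move=> x; apply: (inc_inj mf); rewrite /g.
  by apply: (@xgetPex _ 0 [set z | f z = f x]); exists x.
have [orf sg] := inverse_smooth rf fK.
have gK y : 0 <= y <= 1 -> f (g y) = y.
  move=> y01; have [|||x _ <-] := @IVT R f 0 1 y; last by rewrite fK.
  - exact: ler01.
  - by apply: continuous_subspaceT => x; exact: (smooth_on_continuous sf).
  - by rewrite f0 f1 (min_idPl ler01) (max_idPr ler01).
have fI x : 0 <= x <= 1 -> 0 <= f x <= 1.
  by have := mf 0 x; have := mf x 1; rewrite f0 f1 => -> ->.
have gI x : 0 <= x <= 1 -> 0 <= g x <= 1.
  by move=> x01; rewrite -(mf 0) -(mf _ 1) f0 f1 gK.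
have f01 t : 0 <= f (sval (t : unitI R)) <= 1 by apply/fI/unitI01.
have g01 t : 0 <= g (sval (t : unitI R)) <= 1 by apply/gI/unitI01.
split; last exists (fun t => clamp (g (sval t))); last split.
- move=> n U P [oU sP]; apply: (@plot_unitI _ _ _ (fun u => f (sval (P u)))) => //.
  exact: (smooth_on_compR oU _ sP sf).
- move=> n U P [oU sP]; apply: (@plot_unitI _ _ _ (fun u => g (sval (P u)))) => //.
  apply: (smooth_on_compR oU _ sP sg) => u _ /=.
  by exists (g (sval (P u))) => //; rewrite gK//; exact: unitI01.
- by move=> t; apply: sval_inj; rewrite !sval_clamp ?fK//; rewrite ?fK; exact: unitI01.
- by move=> t; apply: sval_inj; rewrite !sval_clamp ?gK//; rewrite ?gK; exact: unitI01.
Qed.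

(** Plots are parametrized by row vectors. Identifying ['rV_1] with [R] turns smoothness of [phi]
    into smoothness of a real function, as soon as [0, 1] is reached from an open set through
    [h]. *)
Lemma smooth_on_unitI (phi : unitI R -> unitI R) (A : set R) (h : R -> R) :
  smooth (unitI R) (unitI R) phi -> open A -> smooth_on A h ->
  (forall t, A t -> 0 <= h t <= 1) ->
  smooth_on A (fun t => sval (phi (clamp (h t))) : R).
Proof.
move=> sphi oA sh h01; pose c (u : 'rV[R]_1) : R := u 0 0.
have sc : smooth_on setT c.
  move=> k; apply: (@diffn_coord _ k _ _ _ id); first exact: openT.
  exact: smooth_on_id.
pose U := setT `&` c @^-1` A.
have oU : open U by apply: open_preimage_on => //; exact: openT.
have scU : smooth_on U c by exact: smooth_on_sub sc.
have pP : plot (unitI R) U (clamp \o (h \o c)).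
  apply: plot_unitI => //; last by move=> u [_ /h01].
  by apply: (smooth_on_compR oU _ scU sh) => u [].
have [_ sQ] := sphi _ _ _ pP.
pose d (t : R) : 'rV[R]_1 := t *: const_mx 1.
have dc t : c (d t) = t by rewrite /c /d !mxE mulr1.
have sd : smooth_on A d.
  by move=> k; apply: (@diffnZ _ k _ _ A id) => //;
    [exact: smooth_on_id|exact: diffn_cst].
have := smooth_on_comp oA _ sd sQ.
move=> /(_ _)/wrap[t At|]; first by split=> //=; rewrite dc.
apply: eq_smooth_on => // t At /=.
by rewrite dc.
Qed.

(** [F] is [phi] continued by the identity. The one-sided behaviour at 0 and 1 need not match, which
    is why regularity leaves out these two points. *)
Lemma diffeomorphism_extend (phi : unitI R -> unitI R) :
  diffeomorphism (unitI R) (unitI R) phi -> phi i0 = i0 -> phi i1 = i1 ->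
  exists F : R -> R,
  [/\ {homo F : x y / x < y},
      forall t, t <= 0 \/ 1 <= t -> F t = t,
      forall y, exists x, F x = y,
      forall t, t != 0 -> t != 1 -> regular F t &
      forall t, phi (clamp t) = clamp (F t)].
Proof.
move=> [sphi [psi [spsi phiK psiK]]] phi0 phi1.
have psi0 : psi i0 = i0 by rewrite -phi0 phiK.
have psi1 : psi i1 = i1 by rewrite -phi1 phiK.
pose p t : R := sval (phi (clamp t)); pose q t : R := sval (psi (clamp t)).
have oI := @open_lt_lt 0 1; set I := [set x : R | 0 < x < 1] in oI.
have I01 t : I t -> 0 <= t <= 1 by rewrite /I/=; rlra.
have sp : smooth_on I p.
  exact: (@smooth_on_unitI phi I id sphi oI (@smooth_on_id _ _ _) I01).
have sq : smooth_on I q.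
  exact: (@smooth_on_unitI psi I id spsi oI (@smooth_on_id _ _ _) I01).
have inI (f g : unitI R -> unitI R) t : cancel f g -> f i0 = i0 -> f i1 = i1 ->
    I t -> I (sval (f (clamp t))).
  move=> fK f0 f1 It; have := unitI01 (f (clamp t)).
  have t01 := I01 _ It; move: It; rewrite /I /= => It.
  have neq (i : unitI R) : f i = i -> sval i != t -> sval (f (clamp t)) != sval i.
    move=> fi; apply: contra => /eqP/sval_inj; rewrite -{1}fi.
    by move/(can_inj fK) <-; rewrite sval_clamp.
  have n0 : sval (f (clamp t)) != 0.
    by have := neq i0 f0; rewrite sval_i0; apply; rlra.
  have n1 : sval (f (clamp t)) != 1.
    by have := neq i1 f1; rewrite sval_i1; apply; rlra.
  by move: n0 n1; rlra.
have pI t : I t -> I (p t) by exact: inI phiK phi0 phi1.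
have qI t : I t -> I (q t) by exact: inI psiK psi0 psi1.
have pK t : I t -> q (p t) = t.
  by move=> It; rewrite /q /p clampK phiK sval_clamp//; exact: I01.
have qK t : I t -> p (q t) = t.
  by move=> It; rewrite /q /p clampK psiK sval_clamp//; exact: I01.
have p0 : p 0 = 0 by rewrite /p -/i0 phi0 sval_i0.
have p1 : p 1 = 1 by rewrite /p -/i1 phi1 sval_i1.
have pinj x y : 0 <= x <= 1 -> 0 <= y <= 1 -> p x = p y -> x = y.
  move=> x01 y01 /sval_inj/(can_inj phiK) /(congr1 sval).
  by rewrite !sval_clamp.
have step01 (t : R) : 0 <= step t <= 1 by rewrite step_ge0 step_le1.
(* [p] is only known to be continuous at 0 and 1 after composition with plots. *)
have ps : {in `[0, 1]%R &, {mono (p \o step) : x y / x <= y}}.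
  apply: segment_continuous_inj_le.
  - by rewrite /= step_le0// step_ge1// p0 p1 ler01.
  - apply: continuous_subspaceT => x; apply: (@smooth_on_continuous _ _ _ setT) => //.
    by apply: smooth_on_unitI => //; [exact: openT|exact: step_smooth openT].
  - move=> x y; rewrite !in_itv/= => x01 y01 /(pinj _ _ (step01 x) (step01 y)) sxy.
    apply/eqP; rewrite eq_le !leNgt; apply/andP; split; apply/negP => xy.
      by have := step_lt _ xy _; rewrite sxy ltxx; rlra.
    by have := step_lt _ xy _; rewrite sxy ltxx; rlra.
have plt x y : 0 <= x <= 1 -> 0 <= y <= 1 -> x < y -> p x < p y.
  move=> /step_surj[x' x01 <-] /step_surj[y' y01 <-] xy.
  have xy' : x' < y' by rewrite ltNge; apply/negP => /step_le; rewrite leNgt xy.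
  by rewrite ltNge [_ <= _]ps ?in_itv// -ltNge.
(* Monotonicity gives a nonnegative derivative, and the chain rule for [q \o p = id] excludes 0. *)
have dp t : I t -> 0 < 'D_1 p t.
  move=> It; have dpt := smooth_on_is_derive sp It.
  have dqt := smooth_on_is_derive sq (pI _ It).
  have [_ E] := is_derive1_comp dqt dpt.
  have : 'D_1 (q \o p) t = 'D_1 id t.
    by apply: near_eq_derive; apply: (open_near_eq oI) => // x; rewrite inE; exact: pK.
  rewrite E derive_id => E1.
  have : 0 <= 'D_1 p t.
    rewrite -derive1E; apply: (@incr_derive1_ge0_itv _ _ true false 0 1).
    - move=> x; rewrite inE/= in_itv/= => Ix.
      by have [] := smooth_on_is_derive sp Ix.
    - by move=> x y; rewrite !in_itv/= => x01 y01; exact: plt.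
    - by rewrite in_itv.
  rewrite le_eqVlt => /predU1P[E0|//]; move: E1; rewrite -E0 mulr0 => /eqP.
  by rewrite eq_sym oner_eq0.
pose F t := if 0 < t < 1 then p t else t.
have FI t : I t -> F t = p t by rewrite /F /I /= => ->.
have FN t : t <= 0 \/ 1 <= t -> F t = t.
  by move=> t01; rewrite /F ifF//; apply/negbTE; case: t01; rlra.
have rN (U : set R) t : open U -> U t ->
    (forall x, U x -> x <= 0 \/ 1 <= x) -> regular F t.
  move=> oU Ut UN; apply: (@eq_regular _ U id) => //; last exact: regular_id.
  by move=> x Ux; rewrite FN//; exact: UN.
exists F; split=> //.
- move=> x y xy; rewrite /F; case: ifPn => x01; case: ifPn => y01 //.
  + by apply: plt; rlra.
  + by have := pI _ x01; rewrite /I/=; rlra.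
  + by have := pI _ y01; rewrite /I/=; rlra.
- move=> y; have [Iy|Iy] := boolP (0 < y < 1).
    by exists (q y); rewrite FI ?qK//; exact: qI.
  by exists y; rewrite /F (negbTE Iy).
- move=> t t0 t1; have [tlt0|tgt0|t00] := ltgtP t 0; last by rewrite t00 eqxx in t0.
    by apply: (rN _ _ (@open_lt R 0) tlt0) => x /= /ltW; left.
  have [tlt1|tgt1|t11] := ltgtP t 1; last by rewrite t11 eqxx in t1.
    have It : I t by rewrite /I/= tgt0.
    apply: (@eq_regular _ I p) => //; first by move=> x /FI.
    by exists I.
  by apply: (rN _ _ (@open_gt R 1) tgt1) => x /= /ltW; right.
- move=> t; rewrite /F; case: ifPn => It; first by rewrite clampK.
  have [t0|t0] := leP t 0; first by rewrite clamp_le0.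
  by rewrite clamp_ge1//; move: It; rewrite t0/=; rlra.
Qed.

End unit_interval.

(** * Reparametrization of paths *)

Section regularize.
Context {R : realType}.

Lemma seq_separated (S : seq R) (s : R) : exists2 r, 0 < r &
  forall t, t \in S -> t != s -> 2 * r <= `|t - s|.
Proof.
elim: S => [|u S [r r0 rS]]; first by exists 1.
have [->|us] := eqVneq u s.
  by exists r => // t; rewrite inE => /predU1P[->|/rS//]; rewrite eqxx.
exists (Num.min r (`|u - s| / 2)).
  by rewrite lt_min r0 divr_gt0// normr_gt0 subr_eq0.
move=> t; rewrite inE => /predU1P[-> _|/rS H /H {H}].
  by rewrite mulrC -ler_pdivlMr// ge_min lexx orbT.
by apply: le_trans; rewrite ler_pM2l// ge_min lexx.
Qed.

(** The exceptional points are removed one at a time. Each correction is confined to a neighbourhood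
    so small that [beta] does not notice it and that the situation near the remaining points is
    unchanged. *)
Lemma regularize_seq (T : Type) (beta : R -> T) (f : R -> R) (S : seq R) :
  {homo f : x y / x < y} -> f 0 = 0 -> f 1 = 1 ->
  (forall t, t \notin S -> regular f t) ->
  (forall s, s \in S -> exists2 d, 0 < d &
    forall y, f (s - d) <= y <= f (s + d) -> beta y = beta (f s)) ->
  exists g, [/\ forall t, regular g t, g 0 = 0, g 1 = 1 &
    forall t, beta (g t) = beta (f t)].
Proof.
elim: S f => [|s S IH] f hf f0 f1 rf cf; first by exists f; split=> // t; exact: rf.
have [sS|sS] := boolP (s \in S).
  apply: IH => // t tS; [apply: rf|apply: cf]; rewrite inE ?tS ?orbT//.
  by rewrite negb_or tS andbT; apply: contraNneq tS => ->.
have [d d0 cd] : exists2 d, 0 < d &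
    forall y, f (s - d) <= y <= f (s + d) -> beta y = beta (f s).
  by apply: cf; rewrite mem_head.
(* 0 and 1 join the points to be avoided so that the normalization at the ends survives the
   correction. *)
have [r r0 rS] := seq_separated [:: 0, 1 & S] s.
pose e := Num.min d r.
have e0 : 0 < e by rewrite lt_min d0.
have ed : e <= d by rewrite ge_min lexx.
have er : e <= r by rewrite ge_min lexx orbT.
have mf := le_mono hf.
have [g [hg gf gs rgs rg]] := regularize s hf e0.
have mg := le_mono hg.
have gfS t : t \in [:: 0, 1 & S] -> g t = f t.
  move=> tS; have [->//|ts] := eqVneq t s.
  by apply: gf; have := rS _ tS ts; lra.
have bg t : beta (g t) = beta (f t).
  have [ts|ts] := leP e `|t - s|; first by rewrite gf.
  have {}ts : s - e <= t <= s + e by move: ts; rewrite ltr_norml; lra.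
  have gE x : x = s - e \/ x = s + e -> g x = f x.
    move=> [->|->]; apply: gf; rewrite addrAC subrr add0r ?normrN; exact: ler_norm.
  rewrite !cd//; apply/andP; split.
  - by rewrite mf; lra.
  - by rewrite mf; lra.
  - apply: (@le_trans _ _ (g (s - e))); last by rewrite mg; lra.
    by rewrite gE ?mf; [lra|left].
  - apply: (@le_trans _ _ (g (s + e))); first by rewrite mg; lra.
    by rewrite gE ?mf; [lra|right].
have [||||h [rh h0 h1 bh]] := IH g hg.
- by rewrite gfS ?inE ?eqxx.
- by rewrite gfS ?inE ?eqxx ?orbT.
- move=> t tS; have [->//|ts] := eqVneq t s.
  by apply: rg; apply: rf; rewrite inE negb_or ts.
- move=> t tS; have tsS : t \in s :: S by rewrite inE tS orbT.
  have [d' d'0 cd'] := cf t tsS.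
  have ts : t != s by apply: contraNneq sS => <-.
  have {}ts : 2 * r <= `|t - s| by apply: rS => //; rewrite !inE tS !orbT.
  pose d'' := Num.min d' r.
  have d''d : d'' <= d' by rewrite ge_min lexx.
  have d''r : d'' <= r by rewrite ge_min lexx orbT.
  have d''0 : 0 < d'' by rewrite lt_min d'0.
  exists d'' => // y; rewrite !bg.
  (* The factor 2 in the separation: a point within [r] of [t] is still at distance at least [r]
     from [s], where [g] agrees with [f]. *)
  have far x : `|x - t| <= d'' -> e <= `|x - s|.
    move=> xt; have := ler_distD x t s; rewrite [`|t - x|]distrC; lra.
  rewrite !gf; first last.
  + by apply: far; rewrite addrAC subrr add0r normrN ger0_norm ?lexx ?(ltW d''0).
  + by apply: far; rewrite addrAC subrr add0r ger0_norm ?lexx ?(ltW d''0).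
  move=> /andP[y1 y2]; apply: cd'; apply/andP; split.
    by apply: le_trans y1; rewrite mf; lra.
  by apply: le_trans y2 _; rewrite mf; lra.
by exists h; split=> // t; rewrite bh.
Qed.

(** An increasing surjection is continuous, put in the form in which [regularize_seq] asks for
    neighbourhoods of constancy. *)
Lemma homo_surj_near (F : R -> R) s e : {homo F : x y / x < y} ->
  (forall y, exists x, F x = y) -> 0 < e ->
  exists2 d, 0 < d & F s - e <= F (s - d) /\ F (s + d) <= F s + e.
Proof.
move=> hF sF e0; have mF := le_mono hF.
have [x Fx] := sF (F s - e); have [y Fy] := sF (F s + e).
have xs : x < s by rewrite ltNge -mF Fx; lra.
have sy : s < y by rewrite ltNge -mF Fy; lra.
exists (Num.min (s - x) (y - s)); first by rewrite lt_min !subr_gt0 xs.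
have m1 : Num.min (s - x) (y - s) <= s - x by rewrite ge_min lexx.
have m2 : Num.min (s - x) (y - s) <= y - s by rewrite ge_min lexx orbT.
by rewrite -Fx -Fy !mF; split; lra.
Qed.

End regularize.

Section reparam.
Context {R : realType} {X : diffSpace R}.
Implicit Types a b c : pathSpace X.

(** The path continued by constants to the whole line, so that arguments such as [2 * t - 1] need no
    proof of lying in [0, 1]. *)
Definition evc a (t : R) : X := ev a (clamp t).

Lemma ev_evc a t : ev a t = evc a (sval t).
Proof. by rewrite /evc clampK. Qed.

Lemma path_ext a b : (forall t, 0 <= t <= 1 -> evc a t = evc b t) -> a = b.
Proof.
move=> ab; apply: sval_inj; apply/funext => t.
by rewrite -/(ev a t) -/(ev b t) !ev_evc ab//; exact: unitI01.
Qed.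

Lemma evc_le0 a t : t <= 0 -> evc a t = ev a i0.
Proof. by move=> t0; rewrite /evc clamp_le0. Qed.

Lemma evc_ge1 a t : 1 <= t -> evc a t = ev a i1.
Proof. by move=> t1; rewrite /evc clamp_ge1. Qed.

(** The width is explicit because concatenating plots of paths needs one width for all
    parameters. *)
Definition sits (e : R) a := forall t,
  (t < e -> evc a t = ev a i0) /\ (1 - e < t -> evc a t = ev a i1).

Lemma sits_le e e' a : e' <= e -> sits e a -> sits e' a.
Proof. by move=> ee sa t; split=> te; [apply: (sa t).1|apply: (sa t).2]; rlra. Qed.

Lemma sitsP e a : 0 < e -> sits e a -> sitting a.
Proof. by move=> e0 sa; exists e => // t; rewrite ev_evc; exact: sa. Qed.

Lemma sitting_sits a : sitting a -> exists2 e, 0 < e <= 4^-1 & sits e a.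
Proof.
move=> [e e0 sa]; exists (Num.min e 4^-1).
  by rewrite lt_min e0 ge_min lexx orbT andbT /=; rlra.
apply: (@sits_le e); first by rewrite ge_min lexx.
move=> t; have [t0|t0] := leP t 0.
  rewrite (evc_le0 _ t0); split=> // te.
  by have [_] := sa i0; rewrite sval_i0; apply; rlra.
have [t1|t1] := leP 1 t.
  rewrite (evc_ge1 _ t1); split=> // te.
  by have [+ _] := sa i1; rewrite sval_i1; apply; rlra.
by have := sa (clamp t); rewrite sval_clamp//; rlra.
Qed.

Lemma evc_vee b a t : sitting b -> sitting a -> ev b i0 = ev a i1 ->
  evc (vee b a) t = if t < 2^-1 then evc a (2 * t) else evc b (2 * t - 1).
Proof.
move=> sb sa ba; rewrite {1}/evc ev_vee// /concat.
have [t0|t0] := leP t 0.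
  rewrite clamp_le0// sval_i0 !ifT; [|rlra|rlra].
  by rewrite -!/(evc _ _) !evc_le0//; rlra.
have [t1|t1] := leP 1 t; last by rewrite sval_clamp//; rlra.
rewrite clamp_ge1// sval_i1 !ifF; [|apply/negbTE; rlra|apply/negbTE; rlra].
by rewrite -!/(evc _ _) !evc_ge1//; rlra.
Qed.

Lemma evc_rpath a t : evc (rpath a) t = evc a (1 - t).
Proof.
rewrite {1}/evc /ev /= /reverse -/(ev a _) -/(evc a _).
have [t0|t0] := leP t 0; first by rewrite clamp_le0// sval_i0 !evc_ge1//; rlra.
have [t1|t1] := leP 1 t; first by rewrite clamp_ge1// sval_i1 !evc_le0//; rlra.
by rewrite sval_clamp//; rlra.
Qed.

Lemma reparam_refl a : reparam a a.
Proof.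
exists id; split=> //; split; first by [].
by exists id; split.
Qed.

Lemma reparam_sym a b : reparam a b -> reparam b a.
Proof.
move=> [f [[sf [g [sg fK gK]]] f0 f1 ab]]; exists g; split.
- by split=> //; exists f; split.
- by rewrite -f0 fK.
- by rewrite -f1 fK.
- by move=> t; rewrite ab gK.
Qed.

Lemma reparam_trans b a c : reparam a b -> reparam b c -> reparam a c.
Proof.
move=> [f [[sf [f' [sf' fK f'K]]] f0 f1 ab]].
move=> [g [[sg [g' [sg' gK g'K]]] g0 g1 bc]]; exists (g \o f); split.
- split; first by move=> n U P /sf /sg.
  exists (f' \o g'); split; first by move=> n U P /sg' /sf'.
    exact: can_comp.
  exact: can_comp.
- by rewrite /= f0 g0.
- by rewrite /= f1 g1.
- by move=> t; rewrite ab bc.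
Qed.

(** The working criterion for [reparam]: [f] may have corners at the points of [S], since
    [regularize_seq] smooths them without changing the composite with [b]. *)
Lemma reparam_piecewise a b (f : R -> R) (S : seq R) :
  {homo f : x y / x < y} -> f 0 = 0 -> f 1 = 1 ->
  (forall t, t \notin S -> regular f t) ->
  (forall s, s \in S -> exists2 d, 0 < d &
    forall y, f (s - d) <= y <= f (s + d) -> evc b y = evc b (f s)) ->
  (forall t, 0 <= t <= 1 -> evc a t = evc b (f t)) -> reparam a b.
Proof.
move=> hf f0 f1 rf cf ab.
have [g [rg g0 g1 bg]] := regularize_seq hf f0 f1 rf cf.
exists (fun t => clamp (g (sval t))); split.
- exact: diffeomorphism_regular.
- by rewrite sval_i0 g0.
- by rewrite sval_i1 g1.
- by move=> t; rewrite -/(evc b _) bg ev_evc ab//; exact: unitI01.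
Qed.

Lemma reparam_extend a b : reparam a b -> exists F : R -> R,
  [/\ {homo F : x y / x < y},
      forall t, t <= 0 \/ 1 <= t -> F t = t,
      forall y, exists x, F x = y,
      forall t, t != 0 -> t != 1 -> regular F t &
      forall t, evc a t = evc b (F t)].
Proof.
move=> [phi [dphi phi0 phi1 ab]].
have [F [hF FN sF rF pF]] := diffeomorphism_extend dphi phi0 phi1.
by exists F; split=> // t; rewrite /evc ab pF.
Qed.

Lemma reparam_ends a b : reparam a b -> ev a i0 = ev b i0 /\ ev a i1 = ev b i1.
Proof. by move=> [f [_ f0 f1 ab]]; rewrite !ab f0 f1. Qed.

Lemma reparam_sitting a b : reparam a b -> sitting b -> sitting a.
Proof.
move=> ab /sitting_sits[e /andP[e0 _] sb]; have [a0 a1] := reparam_ends ab.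
have [F [hF FN sF _ abF]] := reparam_extend ab; have mF := le_mono hF.
have e2 : 0 < e / 2 by rlra.
have [d0 d00 [_ H0]] := homo_surj_near 0 hF sF e2.
have [d1 d10 [H1 _]] := homo_surj_near 1 hF sF e2.
rewrite (FN 0) ?add0r in H0; last by left.
rewrite (FN 1) in H1; last by right.
apply: (@sitsP (Num.min d0 d1)); first by rewrite lt_min d00.
have m0 : Num.min d0 d1 <= d0 by rewrite ge_min lexx.
have m1 : Num.min d0 d1 <= d1 by rewrite ge_min lexx orbT.
move=> t; rewrite abF a0 a1; split=> ht; [apply: (sb _).1|apply: (sb _).2].
  have : F t <= F d0 by rewrite mF; rlra.
  by rlra.
have : F (1 - d1) <= F t by rewrite mF; rlra.
by rlra.
Qed.

Definition flip (t : unitI R) : unitI R := clamp (1 - sval t).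

Lemma flipK : involutive flip.
Proof.
move=> t; apply: sval_inj; have := unitI01 t; rewrite /flip => t01.
by rewrite !sval_clamp; rlra.
Qed.

Lemma flip_smooth : smooth (unitI R) (unitI R) flip.
Proof.
move=> n U P [oU sP].
apply: (@plot_eq _ _ _ _ (clamp \o (fun u => - 1 * sval (P u) + 1))).
  by move=> u _; rewrite /flip /= mulN1r addrC.
apply: plot_unitI => //; first exact: smooth_affine.
by move=> u _; have := unitI01 (P u); rlra.
Qed.

Lemma reparam_rpath a b : reparam a b -> reparam (rpath a) (rpath b).
Proof.
move=> [f [[sf [g [sg fK gK]]] f0 f1 ab]].
have flip0 : flip i0 = i1 by rewrite /flip sval_i0 subr0.
have flip1 : flip i1 = i0 by rewrite /flip sval_i1 subrr.
exists (flip \o f \o flip); split.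
- split; first by move=> n U P /flip_smooth /sf /flip_smooth.
  exists (flip \o g \o flip); split.
  + by move=> n U P /flip_smooth /sg /flip_smooth.
  + by move=> t /=; rewrite flipK fK flipK.
  + by move=> t /=; rewrite flipK gK flipK.
- by rewrite /= flip0 f1 flip1.
- by rewrite /= flip1 f0 flip0.
- move=> t; rewrite -[LHS]/(ev a (flip t)) -[RHS]/(ev b (flip (flip (f (flip t))))).
  by rewrite flipK ab.
Qed.

Lemma rpathK a : rpath (rpath a) = a.
Proof.
by apply: path_ext => t _; rewrite !evc_rpath opprB addrCA subrr addr0.
Qed.

(** Reversal exchanges the factors on the nose, the two formulas agreeing at 1/2 by composability.
    It therefore transfers results about one factor to the other. *)
Lemma rpath_vee b a : sitting b -> sitting a -> ev b i0 = ev a i1 ->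
  rpath (vee b a) = vee (rpath a) (rpath b).
Proof.
move=> sb sa ba; have [srb b0 b1] := rpath_sitting sb.
have [sra a0 a1] := rpath_sitting sa.
apply: path_ext => t t01; rewrite evc_rpath !evc_vee// ?a0 ?b1// !evc_rpath.
have [t2|t2|->] := ltgtP t 2^-1.
- by rewrite ifF; [congr (evc b _); rlra|apply/negbTE; rlra].
- by rewrite ifT; [congr (evc a _); rlra|rlra].
- rewrite ifF; last by apply/negbTE; rlra.
  by rewrite evc_le0 ?evc_ge1//; rlra.
Qed.

Lemma rpath_cpath (x : X) : rpath (cpath x) = cpath x.
Proof. by apply: path_ext => t _; rewrite evc_rpath. Qed.

End reparam.

(** * Concatenation up to reparametrization: congruence, units, associativity *)

Section reparam_vee.
Context {R : realType} {X : diffSpace R}.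
Implicit Types a b c : pathSpace X.

(** The map [F] from [a] to [a'] is rescaled to [0, 1/2] and continues as the identity on the second
    half. Its corners move to 0 and 1/2; at the latter both [a'] and [b] are constant. *)
Lemma reparam_vee_r b a a' : sitting b -> sitting a' -> ev b i0 = ev a' i1 ->
  reparam a a' -> reparam (vee b a) (vee b a').
Proof.
move=> sb sa' ba' aa'; have sa := reparam_sitting aa' sa'.
have [_ a1] := reparam_ends aa'; have ba : ev b i0 = ev a i1 by rewrite a1.
have [F [hF FN sF rF aF]] := reparam_extend aa'; have mF := le_mono hF.
have F0 : F 0 = 0 by apply: FN; left.
have F1 : F 1 = 1 by apply: FN; right.
(* The summands [+ 0] give both affine maps the shape required by [regular_affine]. *)
pose f t := 2^-1 * F (2 * t + 0) + 0.
have [eb /andP[eb0 _] hb] := sitting_sits sb.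
have [ea /andP[ea0 ea4] ha] := sitting_sits sa'.
have hf : {homo f : x y / x < y}.
  by move=> x y xy; have : F (2 * x + 0) < F (2 * y + 0);
    [apply: hF; rlra|rewrite /f; rlra].
have sf y : exists x, f x = y.
  have [x Fx] := sF (2 * y); exists (2^-1 * x); rewrite /f.
  have -> : 2 * (2^-1 * x) + 0 = x by rlra.
  by rewrite Fx; rlra.
have f0 : f 0 = 0 by rewrite /f mulr0 !addr0 F0 mulr0.
have f12 : f 2^-1 = 2^-1.
  by rewrite /f (_ : 2 * 2^-1 + 0 = 1) ?F1; rlra.
have fge t : 2^-1 <= t -> f t = t.
  by move=> t2; rewrite /f FN; [rlra|right; rlra].
have flt t : t < 2^-1 -> f t < 2^-1 by move/hf; rewrite f12.
apply: (@reparam_piecewise _ _ _ _ f [:: 0; 2^-1]) => //.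
- by rewrite fge//; rlra.
- move=> t; rewrite !inE negb_or => /andP[t0 t1].
  apply: (@regular_comp _ (fun t => F (2 * t + 0)) (fun x => 2^-1 * x + 0));
    last by apply: regular_affine; rlra.
  apply: (@regular_comp _ (fun t => 2 * t + 0)); first exact: regular_affine.
  by apply: rF; [move: t0|move: t1]; rlra.
- move=> s; rewrite !inE => /orP[/eqP->|/eqP->].
    have e0 : 0 < ea / 4 by rlra.
    have [d d0 [_ H]] := homo_surj_near 0 hf sf e0; exists d => // y.
    rewrite f0 !add0r in H *; move=> /andP[_ yd].
    rewrite !evc_vee// !ifT; [|rlra|rlra].
    by rewrite (ha _).1 ?(ha _).1//; rlra.
  have e0 : 0 < Num.min ea eb / 4 by rewrite divr_gt0// lt_min ea0.
  have [d d0 [H1 H2]] := homo_surj_near 2^-1 hf sf e0; exists d => // y.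
  have m1 : Num.min ea eb <= ea by rewrite ge_min lexx.
  have m2 : Num.min ea eb <= eb by rewrite ge_min lexx orbT.
  rewrite f12 in H1 H2 *; move=> /andP[y1 y2].
  rewrite !evc_vee// ltxx [RHS]evc_le0; last by rlra.
  by case: ifPn => y12; [rewrite ba'; apply: (ha _).2|apply: (hb _).1]; rlra.
- move=> t t01; rewrite !evc_vee//; have [t2|t2] := ltP t 2^-1.
    rewrite flt// aF /f; congr evc.
    by rewrite !addr0 mulrA divff ?mul1r // pnatr_eq0.
  by rewrite fge// ifF//; apply/negbTE; rewrite -leNgt.
Qed.

Lemma reparam_vee_l b b' a : sitting b' -> sitting a -> ev b' i0 = ev a i1 ->
  reparam b b' -> reparam (vee b a) (vee b' a).
Proof.
move=> sb' sa ba bb'; have sb := reparam_sitting bb' sb'.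
have [b0 _] := reparam_ends bb'.
have [sra ra0 ra1] := rpath_sitting sa; have [srb rb0 rb1] := rpath_sitting sb'.
rewrite -[vee b a]rpathK -[vee b' a]rpathK; apply: reparam_rpath.
rewrite !rpath_vee// ?b0//; apply: reparam_vee_r => //.
  by rewrite ra0 rb1.
exact: reparam_rpath.
Qed.

Lemma reparam_vee b b' a a' : sitting b' -> sitting a' -> ev b' i0 = ev a' i1 ->
  reparam b b' -> reparam a a' -> reparam (vee b a) (vee b' a').
Proof.
move=> sb' sa' ba' bb' aa'; apply: (@reparam_trans _ _ (vee b a')).
  apply: reparam_vee_r => //; first exact: reparam_sitting bb' sb'.
  by rewrite (reparam_ends bb').1.
exact: reparam_vee_l.
Qed.

(** The natural comparison map [2 * t - 1] is negative on the first half. It is replaced by a rising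
    line whose values stay in the interval where [a] is constant. *)
Lemma reparam_vee_cpath a : sitting a -> reparam (vee a (cpath (ev a i0))) a.
Proof.
move=> sa; have [e /andP[e0 e4] ha] := sitting_sits sa.
(* [c] solves [2 * c - 1 = e / 2], so both pieces of [f] meet there at height [e / 2]. *)
pose c := (1 + e / 2) / 2; pose k := e / 2 / c.
have c0 : 0 < c by rewrite /c; rlra.
have k0 : 0 < k by rewrite divr_gt0//; rlra.
have kc : k * c = e / 2 by rewrite /k divfK// gt_eqF.
have klt t : t < c -> k * t < e / 2 by move=> tc; rewrite -kc ltr_pM2l.
pose f t := if t < c then k * t + 0 else 2 * t + -1.
apply: (@reparam_piecewise _ _ _ _ f [:: c]).
- move=> x y xy; rewrite /f; case: ifPn => xc; case: ifPn => yc.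
  + by rewrite ltrD2r ltr_pM2l.
  + by have := klt _ xc; move: yc; rewrite -leNgt /c; rlra.
  + by move: xc yc; rewrite -leNgt; rlra.
  + by rlra.
- by rewrite /f c0 mulr0 addr0.
- by rewrite /f ifF; [rlra|apply/negbTE; rewrite /c; rlra].
- move=> t; rewrite inE => tc.
  have [tc'|tc'|E] := ltgtP t c; last by rewrite E eqxx in tc.
    apply: (@eq_regular _ [set x | x < c] (fun t => k * t + 0)) => //.
    + by move=> x /= xc; rewrite /f xc.
    + exact: regular_affine.
  apply: (@eq_regular _ [set x | c < x] (fun t => 2 * t + -1)) => //.
  + by move=> x /= xc; rewrite /f ifF//; apply/negbTE; rewrite -leNgt ltW.
  + exact: regular_affine.
- move=> s; rewrite inE => /eqP->; exists (e / 8) => [|y /andP[_]]; first by rlra.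
  rewrite /f ltxx ifF; last by apply/negbTE; rlra.
  by rewrite /c => yc; rewrite !(ha _).1//; rlra.
- move=> t t01; rewrite evc_vee//; last exact: cpath_sitting.
  rewrite /f; case: ifPn => t2.
    rewrite ifT; last by rewrite /c; rlra.
    rewrite (ha _).1//; have : t < c by rewrite /c; rlra.
    by move/klt; rlra.
  case: ifPn => // tc; rewrite !(ha _).1//; last by move: tc; rewrite /c; rlra.
  by have := klt _ tc; rlra.
Qed.

Lemma reparam_cpath_vee a : sitting a -> reparam (vee (cpath (ev a i1)) a) a.
Proof.
move=> sa; have [sra ra0 ra1] := rpath_sitting sa.
rewrite -[X in reparam X]rpathK -[X in reparam _ X]rpathK; apply: reparam_rpath.
rewrite rpath_vee ?rpath_cpath//; last exact: cpath_sitting.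
by rewrite -ra0; exact: reparam_vee_cpath.
Qed.

(** The comparison map is the classical one with slopes 1/2, 1 and 2, sending the junctions 1/2 and
    3/4 to 1/4 and 1/2. Its two corners thus lie at junctions, where the adjacent paths are
    constant. *)
Lemma reparam_veeA c b a : sitting c -> sitting b -> sitting a ->
  ev c i0 = ev b i1 -> ev b i0 = ev a i1 ->
  reparam (vee (vee c b) a) (vee c (vee b a)).
Proof.
move=> sc sb sa cb ba.
have [scb cb0 cb1] := vee_sitting sc sb cb.
have [sba ba0 ba1] := vee_sitting sb sa ba.
have [ec /andP[ec0 ec4] hc] := sitting_sits sc.
have [eb /andP[eb0 eb4] hb] := sitting_sits sb.
have [ea /andP[ea0 ea4] ha] := sitting_sits sa.
pose e := Num.min ec (Num.min eb ea).
have e0 : 0 < e by rewrite !lt_min ec0 eb0.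
have eec : e <= ec by rewrite ge_min lexx.
have eeb : e <= eb by rewrite !ge_min lexx orbT.
have eea : e <= ea by rewrite !ge_min lexx !orbT.
pose f (t : R) := if t < 2^-1 then 2^-1 * t + 0 else
            if t < 3 / 4 then 1 * t + - 4^-1 else 2 * t + -1.
have c_ba : ev c i0 = ev (vee b a) i1 by rewrite ba1.
have cb_a : ev (vee c b) i0 = ev a i1 by rewrite cb0.
apply: (@reparam_piecewise _ _ _ _ f [:: 2^-1; 3 / 4]).
- move=> x y xy; rewrite /f.
  by case: ifPn => x1; case: ifPn => y1; (try case: ifPn => x2);
    (try case: ifPn => y2); rlra.
- by rewrite /f ifT; rlra.
- by rewrite /f !ifF; [rlra|apply/negbTE; rlra|apply/negbTE; rlra].
- move=> t; rewrite !inE negb_or => /andP[t1 t2].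
  have [t1'|t1'] := ltP t 2^-1.
    apply: (@eq_regular _ [set x | x < 2^-1] (fun t => 2^-1 * t + 0)) => //.
    + by move=> x /= xc; rewrite /f xc.
    + by apply: regular_affine; rlra.
  have [t2'|t2'] := ltP t (3 / 4).
    apply: (@eq_regular _ [set x | 2^-1 < x < 3 / 4] (fun t => 1 * t + - 4^-1)) => //.
    + exact: open_lt_lt.
    + by rewrite /=; move: t1; rlra.
    + by move=> x /= xc; rewrite /f ifF ?ifT//; [|apply/negbTE]; rlra.
    + exact: regular_affine.
  apply: (@eq_regular _ [set x | 3 / 4 < x] (fun t => 2 * t + -1)) => //.
  + by rewrite /=; move: t2; rlra.
  + by move=> x /= xc; rewrite /f !ifF//; apply/negbTE; rlra.
  + exact: regular_affine.
- have evE y : evc (vee c (vee b a)) y = if y < 2^-1 then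
      (if y < 4^-1 then evc a (4 * y) else evc b (4 * y - 1)) else evc c (2 * y - 1).
    rewrite !evc_vee//; case: ifPn => // y2.
    have -> : (2 * y < 2^-1) = (y < 4^-1) by apply/idP/idP; rlra.
    by case: ifPn => y4; congr evc; rlra.
  (* Radius [e / 8] keeps every parameter reached in [a], [b] or [c] within [e / 2] of an end of
     that path. *)
  move=> s; rewrite !inE => /orP[/eqP->|/eqP->]; exists (e / 8); try rlra.
    move=> y; rewrite /f ifT; last by rlra.
    rewrite ifF; last by apply/negbTE; rlra.
    rewrite ifT; last by rlra.
    rewrite ltxx ifT; last by rlra.
    move=> y1; rewrite !evE ifT; last by rlra.
    rewrite [in RHS]ifT; last by rlra.
    rewrite [in RHS]ifF; last by apply/negbTE; rlra.
    rewrite [RHS](hb _).1; last by rlra.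
    by case: ifPn => y4; [rewrite ba; apply: (ha _).2|apply: (hb _).1]; rlra.
  move=> y; rewrite /f ifF; last by apply/negbTE; rlra.
  rewrite ifT; last by rlra.
  rewrite ifF; last by apply/negbTE; rlra.
  rewrite ifF; last by apply/negbTE; rlra.
  rewrite ltxx ifF; last by apply/negbTE; rlra.
  move=> y1; rewrite !evE [in RHS]ifF; last by apply/negbTE; rlra.
  rewrite [RHS](hc _).1; last by rlra.
  case: ifPn => y2; last by apply: (hc _).1; rlra.
  rewrite ifF; last by apply/negbTE; rlra.
  by rewrite cb; apply: (hb _).2; rlra.
- move=> t t01; rewrite !evc_vee// /f.
  have [t1|t1] := ltP t 2^-1.
    have -> : 2^-1 * t + 0 < 2^-1 by rlra.
    have -> : 2 * (2^-1 * t + 0) < 2^-1 by rlra.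
    by congr evc; rlra.
  have [t2|t2] := ltP t (3 / 4).
    have -> : 2 * t - 1 < 2^-1 by rlra.
    have -> : 1 * t + - 4^-1 < 2^-1 by rlra.
    have /negbTE -> : ~~ (2 * (1 * t + - 4^-1) < 2^-1) by rlra.
    by congr evc; rlra.
  have /negbTE -> : ~~ (2 * t - 1 < 2^-1) by rlra.
  by congr evc; rlra.
Qed.

End reparam_vee.

(** * Flattening: a common sitting width for all paths *)

Section smash.
Context {R : realType} {X : diffSpace R}.
Implicit Types a b c : pathSpace X.

(** The transition takes place on the middle third, which is the origin of the width [3^-1] used for
    all lifts. *)
Definition plateau (t : R) : R := step (3 * t + -1).

Lemma plateau01 t : 0 <= plateau t <= 1.
Proof. by rewrite step_ge0 step_le1. Qed.

Lemma plateau_le t : t <= 3^-1 -> plateau t = 0.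
Proof. by move=> t3; apply: step_le0; lra. Qed.

Lemma plateau_ge t : 2 / 3 <= t -> plateau t = 1.
Proof. by move=> t3; apply: step_ge1; lra. Qed.

Lemma plateau_smooth (V : normedModType R) (U : set V) (f : V -> R) :
  open U -> smooth_on U f -> smooth_on U (fun u => plateau (f u)).
Proof.
move=> oU sf; apply: (@smooth_on_compR _ _ _ _ setT (fun u => 3 * f u + -1) step) => //.
  apply: smooth_onD => //; last exact: smooth_on_cst.
  by apply: smooth_onM => //; exact: smooth_on_cst.
exact: step_smooth openT.
Qed.

Definition plateauI (t : unitI R) : unitI R := clamp (plateau (sval t)).

Lemma plateauI_smooth : smooth (unitI R) (unitI R) plateauI.
Proof.
move=> n U P [oU sP].
apply: (@plot_unitI _ _ _ (fun u => plateau (sval (P u)))) => //.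
  exact: plateau_smooth.
by move=> u _; exact: plateau01.
Qed.

Lemma smash_smooth a : smooth (unitI R) X (ev a \o plateauI).
Proof. by move=> n U P /plateauI_smooth; exact: (svalP a). Qed.

Definition smash a : pathSpace X := exist _ _ (@smash_smooth a).

Lemma plateau_clamp (t : R) : plateau (sval (clamp t)) = plateau t.
Proof.
have [t0|t0] := leP t 0; first by rewrite clamp_le0// sval_i0 !plateau_le//; lra.
have [t1|t1] := leP 1 t; first by rewrite clamp_ge1// sval_i1 !plateau_ge//; lra.
by rewrite sval_clamp//; lra.
Qed.

Lemma evc_smash a t : evc (smash a) t = evc a (plateau t).
Proof. by rewrite {1}/evc /ev /= /plateauI -/(evc a _) plateau_clamp. Qed.

Lemma smash_sits a : sits 3^-1 (smash a).
Proof.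
move=> t; rewrite evc_smash [ev _ i0]ev_evc [ev _ i1]ev_evc !evc_smash sval_i0 sval_i1.
by split=> ht; [rewrite !plateau_le//|rewrite !plateau_ge//]; lra.
Qed.

(* The sitting intervals of [a] may be arbitrarily short, but where [a] is not
   yet constant [plateau] is strictly increasing, so it can be replaced by a
   genuine diffeomorphism near the ends. *)
Lemma reparam_smash a : sitting a -> reparam (smash a) a.
Proof.
move=> sa; have [e /andP[e0 e4] ha] := sitting_sits sa.
have stepltE x y : step x < step y -> x < y :> R.
  by move=> sxy; rewrite ltNge; apply/negP => /step_le; rewrite leNgt sxy.
have pick y : 0 < y < 1 -> exists t, [/\ 3^-1 < t, t < 2 / 3 & plateau t = y].
  move=> y01; have [|x x01 sx] := @step_surj R y; first by lra.
  exists ((x + 1) / 3); rewrite /plateau.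
  have -> : 3 * ((x + 1) / 3) + -1 = x by lra.
  have x0 : 0 < x by apply: stepltE; rewrite sx step_le0; lra.
  have x1 : x < 1 by apply: stepltE; rewrite sx step_ge1; lra.
  by split=> //; lra.
have plt x y : 3^-1 <= x -> x < y -> y <= 2 / 3 -> plateau x < plateau y.
  by move=> x3 xy y3; apply: step_lt; lra.
have pltE x y : plateau x < plateau y -> x < y by move/stepltE; lra.
(* [plateau] is kept between [t1] and [t4] and replaced outside by lines through (0, 0) and (1, 1).
   The points [t2] and [t3] delimit neighbourhoods of these two corners on which the values stay
   where [a] is constant. *)
have [t1 [t1l t1r pt1]] : exists t, [/\ 3^-1 < t, t < 2 / 3 & plateau t = e / 2].
  by apply: pick; lra.
have [t2 [t2l t2r pt2]] : exists t, [/\ 3^-1 < t, t < 2 / 3 & plateau t = 3 / 4 * e].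
  by apply: pick; lra.
have [t3 [t3l t3r pt3]] : exists t,
    [/\ 3^-1 < t, t < 2 / 3 & plateau t = 1 - 3 / 4 * e].
  by apply: pick; lra.
have [t4 [t4l t4r pt4]] : exists t, [/\ 3^-1 < t, t < 2 / 3 & plateau t = 1 - e / 2].
  by apply: pick; lra.
have t12 : t1 < t2 by apply: pltE; lra.
have t23 : t2 < t3 by apply: pltE; lra.
have t34 : t3 < t4 by apply: pltE; lra.
pose k1 := e / 2 / t1; pose k2 := e / 2 / (1 - t4).
have k10 : 0 < k1 by rewrite divr_gt0//; lra.
have k20 : 0 < k2 by rewrite divr_gt0//; lra.
have k1t : k1 * t1 = e / 2 by rewrite /k1 divfK// gt_eqF//; lra.
have k2t : k2 * (1 - t4) = e / 2 by rewrite /k2 divfK// gt_eqF//; lra.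
pose f t := if t < t1 then k1 * t + 0 else
            if t <= t4 then plateau t else k2 * t + (1 - k2).
have f1 t : t < t1 -> f t = k1 * t + 0 by rewrite /f => ->.
have f2 t : t1 <= t <= t4 -> f t = plateau t.
  by move=> /andP[? ?]; rewrite /f ifF ?ifT//; apply/negbTE; rewrite -leNgt.
have f3 t : t4 < t -> f t = k2 * t + (1 - k2).
  by move=> ht; rewrite /f !ifF//; apply/negbTE; lra.
have b1 t : t < t1 -> f t < e / 2.
  by move=> ht; rewrite f1// addr0 -k1t ltr_pM2l.
have b3 t : t4 < t -> 1 - e / 2 < f t.
  move=> ht; rewrite f3//; have : k2 * t4 < k2 * t by rewrite ltr_pM2l.
  by move: k2t; lra.
have b2 t : t1 <= t <= t4 -> e / 2 <= f t <= 1 - e / 2.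
  by move=> ht; rewrite f2// -{1}pt1 -pt4 !step_le//; lra.
apply: (@reparam_piecewise _ _ _ _ f [:: t1; t4]).
- move=> x y xy.
  have [x1|x1] := ltP x t1; have [y1|y1] := ltP y t1; try lra.
  + by rewrite !f1// ltrD2r ltr_pM2l.
  + have := b1 _ x1; have [y4|y4] := leP y t4.
      by have : t1 <= y <= t4; [rewrite y1|move/b2; lra].
    by have := b3 _ y4; lra.
  + have [y4|y4] := leP y t4; first by rewrite !f2 ?plt//; lra.
    have [x4|x4] := leP x t4; last by rewrite !f3// ltrD2r ltr_pM2l.
    have : t1 <= x <= t4 by rewrite x1.
    by move=> /b2; have := b3 _ y4; lra.
- by rewrite f1; lra.
- by rewrite f3; lra.
- move=> t; rewrite !inE negb_or => /andP[n1 n4].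
  have [x1|x1] := ltP t t1.
    apply: (@eq_regular _ [set x | x < t1] (fun t => k1 * t + 0)) => //.
      by move=> x /= xc; rewrite f1.
    exact: regular_affine.
  have [x4|x4] := ltP t4 t.
    apply: (@eq_regular _ [set x | t4 < x] (fun t => k2 * t + (1 - k2))) => //.
      by move=> x /= xc; rewrite f3.
    exact: regular_affine.
  apply: (@eq_regular _ [set x | t1 < x < t4] plateau) => //.
  + exact: open_lt_lt.
  + by move: n1 n4; rewrite /=; lra.
  + by move=> x /= xc; rewrite f2//; lra.
  + apply: (@regular_comp _ (fun t => 3 * t + -1) step).
      exact: regular_affine.
    exists [set x | 0 < x < 1]; split.
    * exact: open_lt_lt.
    * by rewrite /=; lra.
    * apply: step_smooth; exact: open_lt_lt.
    * exact: step_derive_gt0.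
- move=> s; rewrite !inE => /orP[/eqP->|/eqP->].
    exists (t2 - t1); first by lra.
    have -> : t1 + (t2 - t1) = t2 by lra.
    move=> y; rewrite (f2 t2) ?(f2 t1); [|lra|lra].
    by rewrite pt1 pt2 => y1; rewrite !(ha _).1//; lra.
  exists (t4 - t3); first by lra.
  have -> : t4 - (t4 - t3) = t3 by lra.
  move=> y; rewrite (f2 t3) ?(f2 t4); [|lra|lra].
  by rewrite pt3 pt4 => y1; rewrite !(ha _).2//; lra.
- move=> t t01; rewrite evc_smash.
  have [x1|x1] := ltP t t1.
    have fb := b1 _ x1.
    have : plateau t <= plateau t1 by apply: step_le; lra.
    by rewrite pt1 => pb; rewrite !(ha _).1//; lra.
  have [x4|x4] := ltP t4 t; last by rewrite f2// x1.
  have fb := b3 _ x4.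
  have : plateau t4 <= plateau t by apply: step_le; lra.
  by rewrite pt4 => pb; rewrite !(ha _).2//; lra.
Qed.

End smash.

(** * Retrace classes *)

Section classes.
Context {R : realType}.

Lemma eq_cls (Y : diffSpace R) (E : Y -> Y -> Prop) x y :
  (forall u v, E u v -> E v u) -> (forall v u w, E u v -> E v w -> E u w) ->
  E x y -> cls E x = cls E y.
Proof.
move=> sE tE Exy; apply: eq_exist; apply/funext => z; apply/propext; split=> Ez.
  by apply: tE Ez; exact: sE.
exact: tE Exy Ez.
Qed.

Lemma cls_eq (Y : diffSpace R) (E : Y -> Y -> Prop) x y :
  (forall u, E u u) -> cls E x = cls E y -> E x y.
Proof. by move=> rE /(congr1 sval) /= ->; exact: rE. Qed.

Context {X : diffSpace R}.
Implicit Types (a b c h : pathSpace X) (x y z w : X).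

Lemma cls_reparam a b : cls (@reparam R X) a = cls (@reparam R X) b <-> reparam a b.
Proof.
split; first by apply: cls_eq; exact: reparam_refl.
by apply: eq_cls; [exact: reparam_sym|exact: reparam_trans].
Qed.

Lemma fclass_retrace a b :
  fclass a = fclass b <-> retrace (cls (@reparam R X) a) (cls (@reparam R X) b).
Proof.
split; first by apply: cls_eq => c; exact: rst_refl.
apply: eq_cls => [c d|d c e]; first exact: rst_sym.
exact: rst_trans.
Qed.

Lemma fclass_reparam a b : reparam a b -> fclass a = fclass b.
Proof. by rewrite /fclass => /cls_reparam ->. Qed.

Definition path_from_to x y a := [/\ sitting a, ev a i0 = x & ev a i1 = y].

Lemma vee_from_to x y z b a :
  path_from_to y z b -> path_from_to x y a -> path_from_to x z (vee b a).
Proof.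
move=> [sb b0 b1] [sa a0 a1].
by have [|s e0 e1] := vee_sitting sb sa; [rewrite b0|split=> //; rewrite ?e0 ?e1].
Qed.

Lemma rpath_from_to x y a : path_from_to x y a -> path_from_to y x (rpath a).
Proof.
by move=> [sa a0 a1]; have [s e0 e1] := rpath_sitting sa; split=> //; rewrite ?e0 ?e1.
Qed.

Lemma cpath_from_to x : path_from_to x x (cpath x).
Proof. by split=> //; exact: cpath_sitting. Qed.

Lemma reparam_from_to x y a b : reparam a b -> path_from_to x y b -> path_from_to x y a.
Proof.
move=> ab [sb b0 b1]; have [a0 a1] := reparam_ends ab.
by split; [exact: reparam_sitting ab sb|rewrite a0|rewrite a1].
Qed.

Lemma veeA x y z w c b a : path_from_to z w c -> path_from_to y z b ->
  path_from_to x y a -> reparam (vee (vee c b) a) (vee c (vee b a)).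
Proof.
move=> [sc c0 c1] [sb b0 b1] [sa a0 a1]; apply: reparam_veeA => //.
  by rewrite c0.
by rewrite b0.
Qed.

Lemma vee_congr x y z b b' a a' : path_from_to y z b' -> path_from_to x y a' ->
  reparam b b' -> reparam a a' -> reparam (vee b a) (vee b' a').
Proof.
by move=> [sb b0 b1] [sa a0 a1]; apply: reparam_vee => //; rewrite b0.
Qed.

Lemma fclass_step x y z w b h a : path_from_to y z b -> path_from_to x y a ->
  path_from_to w y h ->
  fclass (vee b a) = fclass (vee b (vee h (vee (rpath h) a))).
Proof.
move=> [sb b0 b1] [sa a0 a1] [sh h0 h1]; apply/fclass_retrace/rst_step.
exists b, h, a; split=> //; split=> //; first by rewrite b0.
by rewrite h1.
Qed.

Definition sitting_class (p : path_mod X) :=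
  exists2 a, sitting a & p = cls (@reparam R X) a.

Lemma sitting_class_cls a : sitting_class (cls (@reparam R X) a) <-> sitting a.
Proof.
split=> [[b sb /cls_reparam ab]|sa]; last by exists a.
exact: reparam_sitting ab sb.
Qed.

(** Both sides of a retrace step are concatenations of sitting paths, and sitting is invariant under
    [reparam]. Hence a chain that starts at a sitting class never leaves them. *)
Lemma retrace_sitting p q : retrace p q -> sitting_class p <-> sitting_class q.
Proof.
elim=> [{}p {}q [b [h [a [[sb sh sa] [ba ha -> ->]]]]]|//|? ? _ ->//|? ? ? _ -> _ ->//].
have Pb : path_from_to (ev b i0) (ev b i1) b by split.
have Pa : path_from_to (ev a i0) (ev b i0) a by split.
have Ph : path_from_to (ev h i0) (ev b i0) h by split=> //; rewrite ha.
have [s1 _ _] := vee_from_to Pb Pa.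
have [s2 _ _] := vee_from_to Pb (vee_from_to Ph (vee_from_to (rpath_from_to Ph) Pa)).
by rewrite !sitting_class_cls.
Qed.

Lemma fclass_sitting a b : fclass a = fclass b -> sitting b -> sitting a.
Proof.
move=> /fclass_retrace/retrace_sitting ab sb.
by apply/sitting_class_cls/ab/sitting_class_cls.
Qed.

(** A chain of retrace steps lives on reparametrization classes. By [retrace_sitting] each
    intermediate class has a sitting representative, so the chain lifts to paths. *)
Lemma fclass_ind (P : pathSpace X -> pathSpace X -> Prop) :
  (forall a b, P a b -> P b a) ->
  (forall b a c, P a b -> P b c -> P a c) ->
  (forall a b, sitting b -> reparam a b -> P a b) ->
  (forall x y z w b h a, path_from_to y z b -> path_from_to x y a ->
    path_from_to w y h -> P (vee b a) (vee b (vee h (vee (rpath h) a)))) ->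
  forall a b, sitting b -> fclass a = fclass b -> P a b.
Proof.
move=> sP tP rP stP a b sb ab; have sa := fclass_sitting ab sb.
move: ab => /fclass_retrace.
suff H p q : retrace p q -> forall a b, sitting a -> sitting b ->
    p = cls (@reparam R X) a -> q = cls (@reparam R X) b -> P a b.
  by move=> /H; exact.
elim=> {a b sa sb p q} [p q [b0 [h [a0 [[sb sh sa] [ba ha -> ->]]]]]|p|p q _ IH|
  p q r pq IH1 qr IH2] a b.
- have Pb : path_from_to (ev b0 i0) (ev b0 i1) b0 by split.
  have Pa : path_from_to (ev a0 i0) (ev b0 i0) a0 by split.
  have Ph : path_from_to (ev h i0) (ev b0 i0) h by split=> //; rewrite ha.
  have [s1 _ _] := vee_from_to Pb Pa.
  move=> sa' sb' /cls_reparam aE /cls_reparam bE.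
  apply: (tP (vee b0 a0)); first by apply/rP/reparam_sym.
  apply: tP (rP _ _ sb' bE).
  exact: stP Pb Pa Ph.
- by move=> sa sb -> /cls_reparam; exact: rP.
- by move=> sa sb ap bq; apply: sP; exact: IH.
- move=> sa sb ap br.
  have [c sc cq] : sitting_class q by apply/(retrace_sitting pq); exists a.
  by apply: (tP c); [exact: IH1|exact: IH2].
Qed.

(** One induction proves everything at once: the symmetry and transitivity cases need equality of
    endpoints to transport composability with [c]. *)
Lemma fclass_ops a b : sitting b -> fclass a = fclass b ->
  [/\ ev a i0 = ev b i0, ev a i1 = ev b i1, fclass (rpath a) = fclass (rpath b),
    (forall w c, path_from_to (ev b i1) w c -> fclass (vee c a) = fclass (vee c b)) &
    (forall w c, path_from_to w (ev b i0) c -> fclass (vee a c) = fclass (vee b c))].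
Proof.
move: a b; apply: fclass_ind.
- move=> a b [-> -> r l r'].
  by split=> // w c Pc; [rewrite (l _ _ Pc)|rewrite (r' _ _ Pc)].
- move=> b a c [-> -> -> l r] [<- <- -> l' r'].
  by split=> // w d Pd; [rewrite (l _ _ Pd) (l' _ _ Pd)|rewrite (r _ _ Pd) (r' _ _ Pd)].
- move=> a b sb ab; have [a0 a1] := reparam_ends ab.
  have Pb : path_from_to (ev b i0) (ev b i1) b by [].
  split=> //; first exact/fclass_reparam/reparam_rpath.
    move=> w c Pc; apply/fclass_reparam/(vee_congr Pc Pb) => //.
    exact: reparam_refl.
  move=> w c Pc; apply/fclass_reparam/(vee_congr Pb Pc) => //.
  exact: reparam_refl.
- move=> x y z w b h a Pb Pa Ph.
  have Pr := rpath_from_to Ph.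
  have Pra := vee_from_to Pr Pa; have Phra := vee_from_to Ph Pra.
  have [s1 -> ->] := vee_from_to Pb Pa; have [s2 -> ->] := vee_from_to Pb Phra.
  have [[sb b0 b1] [sa a0 a1] [sh h0 h1]] := And3 Pb Pa Ph.
  have [[sra ra0 ra1] [shra hra0 hra1] [sr r0 r1]] := And3 Pra Phra Pr.
  split=> //.
  (* The reverse of the detour [rpath h] followed by [h] is the same detour, so reversal takes a
     retrace step to a retrace step. *)
  + rewrite !rpath_vee// ?b0 ?a1 ?hra1 ?h0 ?ra1 ?r0 ?rpathK//.
    have Pa' := rpath_from_to Pa; have Pb' := rpath_from_to Pb.
    rewrite (fclass_step Pa' Pb' Ph); apply: fclass_reparam; apply: reparam_sym.
    apply: reparam_trans (veeA (vee_from_to Pa' Ph) Pr Pb') _.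
    exact: veeA Pa' Ph (vee_from_to Pr Pb').
  + move=> v c Pc; rewrite -(fclass_reparam (veeA Pc Pb Pa)).
    rewrite -(fclass_reparam (veeA Pc Pb Phra)).
    exact: fclass_step (vee_from_to Pc Pb) Pa Ph.
  + move=> v c Pc; rewrite (fclass_reparam (veeA Pb Pa Pc)).
    rewrite (fclass_step Pb (vee_from_to Pa Pc) Ph); apply: fclass_reparam.
    apply: reparam_sym; apply: reparam_trans (veeA Pb Phra Pc) _.
    have Prac := vee_from_to Pr (vee_from_to Pa Pc).
    apply: (vee_congr Pb (vee_from_to Ph Prac)); first exact: reparam_refl.
    apply: reparam_trans (veeA Ph Pra Pc) _.
    apply: (vee_congr Ph Prac); first exact: reparam_refl.
    exact: veeA Pr Pa Pc.
Qed.

Lemma fclass_from_to x y a b : path_from_to x y b -> fclass a = fclass b ->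
  path_from_to x y a.
Proof.
move=> [sb <- <-] ab; have [e0 e1 _ _ _] := fclass_ops sb ab.
by split=> //; exact: fclass_sitting ab sb.
Qed.

Lemma fclass_vee x y z b b' a a' : path_from_to y z b' -> path_from_to x y a' ->
  fclass b = fclass b' -> fclass a = fclass a' ->
  fclass (vee b a) = fclass (vee b' a').
Proof.
move=> Pb Pa bb' aa'; have [[sb' b0 b1] [sa' a0 a1]] := conj Pb Pa.
have [_ _ _ _ Hb] := fclass_ops sb' bb'; have [_ _ _ Ha _] := fclass_ops sa' aa'.
rewrite b0 in Hb; rewrite a1 in Ha.
by rewrite (Hb _ _ (fclass_from_to Pa aa')) (Ha _ _ Pb).
Qed.

Lemma fclass_rpath a a' : sitting a' -> fclass a = fclass a' ->
  fclass (rpath a) = fclass (rpath a').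
Proof. by move=> sa aa'; have [] := fclass_ops sa aa'. Qed.

Lemma fclass_cpathl x y a : path_from_to x y a -> fclass (vee (cpath y) a) = fclass a.
Proof. by move=> [sa _ <-]; apply: fclass_reparam; exact: reparam_cpath_vee. Qed.

Lemma fclass_cpathr x y a : path_from_to x y a -> fclass (vee a (cpath x)) = fclass a.
Proof. by move=> [sa <- _]; apply: fclass_reparam; exact: reparam_vee_cpath. Qed.

Lemma fclassA x y z w c b a : path_from_to z w c -> path_from_to y z b ->
  path_from_to x y a -> fclass (vee (vee c b) a) = fclass (vee c (vee b a)).
Proof. by move=> Pc Pb Pa; apply/fclass_reparam/(veeA Pc Pb Pa). Qed.

(** Insert the detour along [a] and back between two constant paths, then absorb the constants. *)
Lemma fclass_rpathl x y a : path_from_to x y a ->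
  fclass (vee (rpath a) a) = fclass (cpath x).
Proof.
move=> Pa; have Pr := rpath_from_to Pa; have Pc := cpath_from_to x.
rewrite -[RHS](fclass_cpathl Pc) (fclass_step Pc Pc Pr) rpathK.
have Pac := vee_from_to Pa Pc.
rewrite (fclass_cpathl (vee_from_to Pr Pac)).
by apply: esym; apply: (fclass_vee Pr Pa) => //; exact: fclass_cpathr Pa.
Qed.

Lemma fclass_rpathr x y a : path_from_to x y a ->
  fclass (vee a (rpath a)) = fclass (cpath y).
Proof. by move=> /rpath_from_to/fclass_rpathl; rewrite rpathK. Qed.

End classes.

(** * Plots of paths *)

Section path_plots.
Context {R : realType} {X : diffSpace R}.
Implicit Types (a b : pathSpace X) (n : nat).

Lemma plot_ev n (V : set 'rV[R]_n) Q (t : unitI R) :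
  plot (pathSpace X) V Q -> plot X V (fun v => ev (Q v) t).
Proof.
move=> [oV pQ]; apply: (pQ _ _ id (fun=> t)) => //.
  exact: smooth_on_id.
exact: plot_cst.
Qed.

Lemma plot_smash n (V : set 'rV[R]_n) Q :
  plot (pathSpace X) V Q -> plot (pathSpace X) V (fun v => smash (Q v)).
Proof.
move=> [oV pQ]; split=> // m V' r T sr rV pT.
exact: (pQ _ _ r (plateauI \o T) sr rV (plateauI_smooth pT)).
Qed.

Lemma plot_rpath n (V : set 'rV[R]_n) Q :
  plot (pathSpace X) V Q -> plot (pathSpace X) V (fun v => rpath (Q v)).
Proof.
move=> [oV pQ]; split=> // m V' r T sr rV pT.
exact: (pQ _ _ r (flip \o T) sr rV (flip_smooth pT)).
Qed.

(** The common width provides a window around the junction, the same for all parameters, on which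
    the concatenation does not depend on time and is a plot of endpoints. *)
Lemma plot_vee n (V : set 'rV[R]_n) Q1 Q2 :
  plot (pathSpace X) V Q1 -> plot (pathSpace X) V Q2 ->
  (forall v, V v -> [/\ sits 3^-1 (Q1 v), sits 3^-1 (Q2 v) &
    ev (Q1 v) i0 = ev (Q2 v) i1]) ->
  plot (pathSpace X) V (fun v => vee (Q1 v) (Q2 v)).
Proof.
move=> [oV pQ1] [_ pQ2] HQ; split=> // m V' r T sr rV pT.
have [oV' sT] := pT.
pose tt v : R := sval (T v).
have sitQ v : V' v -> [/\ sitting (Q1 (r v)), sitting (Q2 (r v)) &
    ev (Q1 (r v)) i0 = ev (Q2 (r v)) i1].
  move=> /rV/HQ[s1 s2 e]; split=> //; [apply: sitsP s1|apply: sitsP s2];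
  by rewrite invr_gt0 ltr0n.
have evE v : V' v -> sval (vee (Q1 (r v)) (Q2 (r v))) (T v) =
    if tt v < 2^-1 then evc (Q2 (r v)) (2 * tt v) else evc (Q1 (r v)) (2 * tt v - 1).
  move=> Vv; have [s1 s2 e] := sitQ v Vv.
  by rewrite -evc_vee// /evc clampK.
pose A := V' `&` tt @^-1` [set t | t < 2^-1].
pose B := V' `&` tt @^-1` [set t | 2^-1 < t].
(* Within 1/8 of the junction the rescaled time is within 1/4 of an end, and 1/4 is below the width
   1/3. *)
pose C := V' `&` tt @^-1` [set t | 3 / 8 < t < 5 / 8].
have oA : open A by apply: open_preimage_on => //; exact: open_lt.
have oB : open B by apply: open_preimage_on => //; exact: open_gt.
have oC : open C by apply: open_preimage_on => //; exact: open_lt_lt.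
have sub (S : set _) : S `<=` V' -> smooth_on S tt /\ smooth_on S r.
  by move=> SV; split; exact: smooth_on_sub SV _.
have AV : A `<=` V' by move=> v [].
have BV : B `<=` V' by move=> v [].
have CV : C `<=` V' by move=> v [].
apply: plot_local => v Vv; have [tv|tv|tv] := ltgtP (tt v) 2^-1.
- exists A; split=> //; have [stA srA] := sub _ AV.
  apply: (@plot_eq _ _ _ _ (fun v => ev (Q2 (r v)) (clamp (2 * tt v + 0)))).
    by move=> w Aw; have [Vw /= tw] := Aw; rewrite evE// tw addr0.
  apply: (pQ2 _ _ r (clamp \o (fun w => 2 * tt w + 0)) srA) => [w /AV/rV//|].
  apply: plot_unitI => //; first exact: smooth_affine.
  by move=> w [_ /= tw]; have := unitI01 (T w); rewrite -/(tt w); lra.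
- exists B; split=> //; have [stB srB] := sub _ BV.
  apply: (@plot_eq _ _ _ _ (fun v => ev (Q1 (r v)) (clamp (2 * tt v + -1)))).
    by move=> w Bw; have [Vw /= tw] := Bw; rewrite evE// ltNge (ltW tw).
  apply: (pQ1 _ _ r (clamp \o (fun w => 2 * tt w + -1)) srB) => [w /BV/rV//|].
  apply: plot_unitI => //; first exact: smooth_affine.
  by move=> w [_ /= tw]; have := unitI01 (T w); rewrite -/(tt w); lra.
- exists C; split=> //; first by split=> //=; rewrite tv; lra.
  have [stC srC] := sub _ CV.
  apply: (@plot_eq _ _ _ _ (fun v => ev (Q1 (r v)) i0)).
    move=> w Cw; have [Vw /= tw] := Cw; rewrite evE//.
    have [s1 s2 e] := HQ _ (rV _ Vw); apply: esym.
    case: ltP => tw'; last by apply: (s1 _).1; rlra.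
    by rewrite e; apply: (s2 _).2; rlra.
  apply: (pQ1 _ _ r (fun=> i0) srC) => [w /CV/rV//|].
  exact: plot_cst.
Qed.

(** [plateau] makes the path sit at both ends. The constant default does not occur when the segment
    lies in the domain of the plot [P]. *)
Definition segpath n (P : 'rV[R]_n -> X) (u v : 'rV[R]_n) : pathSpace X :=
  match pselect (smooth (unitI R) X
      (fun t => P (u + plateau (sval t) *: (v - u)))) with
  | left h => exist _ _ h
  | right _ => cpath (P u)
  end.

Section segpath.
Variables (n : nat) (U : set 'rV[R]_n) (P : 'rV[R]_n -> X) (u : 'rV[R]_n).
Hypothesis pP : plot X U P.

Let star v := forall s : R, 0 <= s <= 1 -> U (u + s *: (v - u)).

Lemma plot_segment m (V : set 'rV[R]_m) (r : 'rV[R]_m -> 'rV[R]_n) T :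
  smooth_on V r -> plot (unitI R) V T -> (forall v, V v -> star (r v)) ->
  plot X V (fun v => P (u + plateau (sval (T v)) *: (r v - u))).
Proof.
move=> sr [oV sT] rs.
apply: (plot_comp (r := fun v => u + plateau (sval (T v)) *: (r v - u)) pP) => //.
  apply: smooth_onD => //; first exact: smooth_on_cst.
  move=> k; apply: diffnZ => //; first exact: plateau_smooth.
  by apply: diffnD => //; exact: diffn_cst.
by move=> v Vv; apply: rs => //; exact: plateau01.
Qed.

Lemma ev_segpath v t : star v ->
  ev (segpath P u v) t = P (u + plateau (sval t) *: (v - u)).
Proof.
rewrite /segpath => sv; case: pselect => //; case=> m V T pT.
by apply: plot_segment => //; exact: smooth_on_cst.
Qed.

Lemma segpathP v : star v ->
  sits 3^-1 (segpath P u v) /\ path_from_to (P u) (P v) (segpath P u v).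
Proof.
move=> sv.
have E0 : ev (segpath P u v) i0 = P u.
  by rewrite ev_segpath// sval_i0 plateau_le ?scale0r ?addr0//; rlra.
have E1 : ev (segpath P u v) i1 = P v.
  by rewrite ev_segpath// sval_i1 plateau_ge ?scale1r ?[u + _]addrC ?subrK//; rlra.
have s3 : sits 3^-1 (segpath P u v).
  move=> t; rewrite E0 E1 /evc ev_segpath// plateau_clamp; split=> t3.
    by rewrite plateau_le ?scale0r ?addr0//; rlra.
  by rewrite plateau_ge ?scale1r ?[u + _]addrC ?subrK//; rlra.
split=> //; split=> //; apply: sitsP s3; by rewrite invr_gt0.
Qed.

Lemma plot_segpath V : open V -> (forall v, V v -> star v) ->
  plot (pathSpace X) V (segpath P u).
Proof.
move=> oV sV; split=> // m V' r T sr rV pT.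
apply: (@plot_eq _ _ _ _ (fun v => P (u + plateau (sval (T v)) *: (r v - u)))).
  by move=> v Vv; rewrite -/(ev _ _) ev_segpath//; apply/sV/rV.
by apply: plot_segment => // v /rV/sV.
Qed.


End segpath.
End path_plots.

(** * The bundle *)

Section bundle.
Context {R : realType} {X : diffSpace R} (pt : X).
Implicit Types (a b c : pathSpace X) (p q : Fpt pt) (g h : Omega pt).

Lemma Frep_from_to p : path_from_to pt (tau p) (Frep p).
Proof. by have [[sp _] p0] := FrepP p; split. Qed.

Lemma Fpt_rep p a : represents a (sval p) ->
  path_from_to pt (tau p) a /\ sval p = fclass a.
Proof.
move=> [sa pa]; split=> //; have [[_ pr] _] := FrepP p.
by apply: fclass_from_to (Frep_from_to p) _; rewrite -pa.
Qed.

Lemma Omega_rep g c : represents c (sval g) ->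
  path_from_to pt pt c /\ sval g = fclass c.
Proof.
move=> [sc gc]; split=> //; have [[so go] [o0 o1]] := OrepP g.
have Po : path_from_to pt pt (Orep g) by split.
by apply: fclass_from_to Po _; rewrite -gc.
Qed.

Lemma FrepE p : represents (Frep p) (sval p).
Proof. by have [] := FrepP p. Qed.

Lemma OrepE g : represents (Orep g) (sval g).
Proof. by have [] := OrepP g. Qed.

(** Independence of the chosen representatives, by [fclass_vee]. The algebraic laws and the
    smoothness of the action are read off on convenient representatives through this lemma. *)
Lemma Fvee_rep p g a c : represents a (sval p) -> represents c (sval g) ->
  represents (vee a c) (sval (Fvee p g)).
Proof.
move=> /Fpt_rep[Pa pa] /Omega_rep[Pc gc]; split; first by have [] := vee_from_to Pa Pc.
have [_ pr] := Fpt_rep (FrepE p); have [_ gr] := Omega_rep (OrepE g).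
by apply: (fclass_vee Pa Pc); rewrite -?pr -?gr.
Qed.

Lemma Omul_rep g h c s : represents c (sval g) -> represents s (sval h) ->
  represents (vee c s) (sval (Omul g h)).
Proof.
move=> /Omega_rep[Pc gc] /Omega_rep[Ps hs].
split; first by have [] := vee_from_to Pc Ps.
have [_ gr] := Omega_rep (OrepE g); have [_ hr] := Omega_rep (OrepE h).
by apply: (fclass_vee Pc Ps); rewrite -?hr -?gr.
Qed.

Lemma Oinv_rep g c : represents c (sval g) -> represents (rpath c) (sval (Oinv g)).
Proof.
move=> /Omega_rep[Pc gc]; split; first by have [] := rpath_from_to Pc.
have [sc _ _] := Pc; have [_ gr] := Omega_rep (OrepE g).
by apply: fclass_rpath sc _; rewrite -gr.
Qed.

Lemma Oone_rep : represents (cpath pt) (sval (Oone pt)).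
Proof. by split=> //; exact: cpath_sitting. Qed.

Lemma tau_Fvee p g : tau (Fvee p g) = tau p.
Proof.
have := Fvee_rep (FrepE p) (OrepE g) => /Fpt_rep[[_ _ <-] _].
have [Pg _] := Omega_rep (OrepE g).
by have [] := vee_from_to (Frep_from_to p) Pg.
Qed.

Lemma OmulA : associative (@Omul R X pt).
Proof.
move=> g h k; have [[Rg Rh] Rk] := ((OrepE g, OrepE h), OrepE k).
apply: sval_inj; have [_ ->] := Omul_rep Rg (Omul_rep Rh Rk).
have [_ ->] := Omul_rep (Omul_rep Rg Rh) Rk.
have [[Pg _] [Ph _] [Pk _]] := And3 (Omega_rep Rg) (Omega_rep Rh) (Omega_rep Rk).
by apply: esym; exact: fclassA Pg Ph Pk.
Qed.

Lemma Omul1 : right_id (Oone pt) (@Omul R X pt).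
Proof.
move=> g; have Rg := OrepE g; apply: sval_inj.
have [_ ->] := Omul_rep Rg Oone_rep; have [Pg ->] := Omega_rep Rg.
exact: fclass_cpathr Pg.
Qed.

Lemma O1mul : left_id (Oone pt) (@Omul R X pt).
Proof.
move=> g; have Rg := OrepE g; apply: sval_inj.
have [_ ->] := Omul_rep Oone_rep Rg; have [Pg ->] := Omega_rep Rg.
exact: fclass_cpathl Pg.
Qed.

Lemma OVmul : left_inverse (Oone pt) (@Oinv R X pt) (@Omul R X pt).
Proof.
move=> g; have Rg := OrepE g; apply: sval_inj.
have [_ ->] := Omul_rep (Oinv_rep Rg) Rg; have [Pg _] := Omega_rep Rg.
exact: fclass_rpathl Pg.
Qed.

Lemma OmulV : right_inverse (Oone pt) (@Oinv R X pt) (@Omul R X pt).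
Proof.
move=> g; have Rg := OrepE g; apply: sval_inj.
have [_ ->] := Omul_rep Rg (Oinv_rep Rg); have [Pg _] := Omega_rep Rg.
exact: fclass_rpathr Pg.
Qed.

Lemma Fvee1 p : Fvee p (Oone pt) = p.
Proof.
have Rp := FrepE p; apply: sval_inj.
have [_ ->] := Fvee_rep Rp Oone_rep; have [Pp ->] := Fpt_rep Rp.
exact: fclass_cpathr Pp.
Qed.

Lemma FveeM p g h : Fvee (Fvee p g) h = Fvee p (Omul g h).
Proof.
have [[Rp Rg] Rh] := ((FrepE p, OrepE g), OrepE h); apply: sval_inj.
have [_ ->] := Fvee_rep (Fvee_rep Rp Rg) Rh.
have [_ ->] := Fvee_rep Rp (Omul_rep Rg Rh).
have [[Pp _] [Pg _] [Ph _]] := And3 (Fpt_rep Rp) (Omega_rep Rg) (Omega_rep Rh).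
exact: fclassA Pp Pg Ph.
Qed.

(** Left cancellation of [a] recovers the loop. This gives freeness of the action and the formula
    for the inverse of the shear map. *)
Lemma Fvee_div p g a b : represents a (sval p) -> represents b (sval (Fvee p g)) ->
  sval g = fclass (vee (rpath a) b).
Proof.
move=> Ra Rb; have Rg := OrepE g; have [Pg ->] := Omega_rep Rg.
have [Pa _] := Fpt_rep Ra; have Pr := rpath_from_to Pa.
have [Pb bE] := Fpt_rep Rb; rewrite tau_Fvee in Pb.
have [_ gE] := Fvee_rep Ra Rg.
transitivity (fclass (vee (rpath a) (vee a (Orep g)))); last first.
  by apply: (fclass_vee Pr Pb) => //; rewrite -gE.
rewrite -(fclassA Pr Pa Pg); apply: esym.
rewrite -[RHS](fclass_cpathl Pg).
by apply: (fclass_vee (cpath_from_to pt) Pg) => //; exact: fclass_rpathl Pa.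
Qed.

(** The loop is [Frep q] followed by the reverse of [Frep p]; it closes because the two paths share
    both endpoints. *)
Lemma Fvee_transitive p q : tau p = tau q -> exists g, q = Fvee p g.
Proof.
move=> pq; have [Rp Rq] := (FrepE p, FrepE q).
have [Pp _] := Fpt_rep Rp; have [Pq qE] := Fpt_rep Rq.
rewrite -pq in Pq; have Pr := rpath_from_to Pp.
have Pg := vee_from_to Pr Pq; have [sg g0 g1] := Pg.
have Og : Omega_set pt (fclass (vee (rpath (Frep p)) (Frep q))).
  by exists (vee (rpath (Frep p)) (Frep q)).
exists (exist _ _ Og); apply: sval_inj.
have Rg : represents (vee (rpath (Frep p)) (Frep q))
  (sval (exist _ _ Og : Omega pt)) by split.
have [_ ->] := Fvee_rep Rp Rg.
rewrite -(fclassA Pp Pr Pq) qE -[LHS](fclass_cpathl Pq).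
apply: (fclass_vee (vee_from_to Pp Pr) Pq) => //.
by apply: esym; exact: fclass_rpathr Pp.
Qed.

(** * Plots of classes and smoothness of the operations *)

Lemma plot_fclass n (U : set 'rV[R]_n) Q :
  plot (pathSpace X) U Q -> plot (Fspace X) U (fun u => fclass (Q u)).
Proof.
move=> pQ; have oU := plot_open pQ; split=> // u Uu.
exists U, (fun u => cls (@reparam R X) (Q u)); split=> //.
by split=> // v Uv; exists U, Q; split.
Qed.

Lemma plot_fclass_local (A : set (Fspace X)) n (U : set 'rV[R]_n)
    (P : 'rV[R]_n -> subSpace A) :
  (forall u, U u -> exists V Q, [/\ V u, V `<=` U, plot (pathSpace X) V Q &
    forall v, V v -> sval (P v) = fclass (Q v)]) -> plot (subSpace A) U P.
Proof.
move=> H; apply: plot_local => u /H[V [Q [Vu VU pQ PQ]]].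
exists V; split=> //.
apply: (@plot_eq _ (Fspace X) _ _ (fun u => fclass (Q u))); last exact: plot_fclass.
by move=> v /PQ.
Qed.

(* A lift need not sit uniformly in [u]; [smash] makes it do so without
   changing its classes. *)
Lemma plot_lift (A : set (Fspace X)) n (U : set 'rV[R]_n)
    (P : 'rV[R]_n -> subSpace A) :
  (forall x, A x -> exists a, represents a x) -> plot (subSpace A) U P ->
  forall u, U u -> exists V Q, [/\ V u, V `<=` U, plot (pathSpace X) V Q &
    forall v, V v -> sits 3^-1 (Q v) /\ represents (Q v) (sval (P v))].
Proof.
move=> hA [oU pP] u /pP[V1 [Q1 [V1u V1U [oV1 pQ1] PQ1]]].
have [V [Q [Vu VV1 pQ Q1Q]]] := pQ1 _ V1u.
exists V, (fun v => smash (Q v)); split=> //.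
- by move=> v /VV1/V1U.
- exact: plot_smash.
- move=> v Vv; split; first exact: smash_sits.
  have PQ : sval (P v) = fclass (Q v) by rewrite PQ1 ?Q1Q//; exact: VV1.
  have [a [sa Pa]] := hA _ (svalP (P v)).
  (* The quotient diffeology yields an arbitrary path in the class; it sits because some
     representative does and sitting is invariant. *)
  have sQ : sitting (Q v) by apply: fclass_sitting sa; rewrite -PQ.
  split; first exact: reparam_sitting (reparam_smash sQ) sQ.
  by rewrite (fclass_reparam (reparam_smash sQ)).
Qed.

Lemma Fpt_lift n (U : set 'rV[R]_n) (P : 'rV[R]_n -> Fpt pt) :
  plot (Fpt pt) U P ->
  forall u, U u -> exists V Q, [/\ V u, V `<=` U, plot (pathSpace X) V Q &
    forall v, V v -> sits 3^-1 (Q v) /\ represents (Q v) (sval (P v))].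
Proof. by apply: plot_lift => x [a Ra _]; exists a. Qed.

Lemma Omega_lift n (U : set 'rV[R]_n) (P : 'rV[R]_n -> Omega pt) :
  plot (Omega pt) U P ->
  forall u, U u -> exists V Q, [/\ V u, V `<=` U, plot (pathSpace X) V Q &
    forall v, V v -> sits 3^-1 (Q v) /\ represents (Q v) (sval (P v))].
Proof. by apply: plot_lift => x [a Ra _]; exists a. Qed.

Lemma tau_smooth : smooth (Fpt pt) X (@tau R X pt).
Proof.
move=> n U P /Fpt_lift pP; apply: plot_local => u /pP[V [Q [Vu VU pQ PQ]]].
exists V; split=> //; apply: plot_eq (plot_ev i1 pQ) => v /PQ[_ /Fpt_rep[[_ _ ->]]].
by [].
Qed.

Lemma plot_fclass_vee (A : set (Fspace X)) n (U : set 'rV[R]_n)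
    (P : 'rV[R]_n -> subSpace A) :
  (forall u, U u -> exists V1 V2 Q1 Q2,
    [/\ V1 u, V2 u, V1 `<=` U, plot (pathSpace X) V1 Q1 & plot (pathSpace X) V2 Q2] /\
    forall v, V1 v -> V2 v -> [/\ sits 3^-1 (Q1 v), sits 3^-1 (Q2 v),
      ev (Q1 v) i0 = ev (Q2 v) i1 & sval (P v) = fclass (vee (Q1 v) (Q2 v))]) ->
  plot (subSpace A) U P.
Proof.
move=> H; apply: plot_fclass_local => u.
move=> /H[V1 [V2 [Q1 [Q2 [[V1u V2u V1U pQ1 pQ2] PQ]]]]].
have oV : open (V1 `&` V2) by apply: openI; [exact: plot_open pQ1|exact: plot_open pQ2].
exists (V1 `&` V2), (fun v => vee (Q1 v) (Q2 v)); split=> //.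
- by move=> v [/V1U].
- apply: plot_vee.
  + by apply: plot_sub pQ1 => // v [].
  + by apply: plot_sub pQ2 => // v [].
  + by move=> v [V1v V2v]; have [] := PQ v V1v V2v.
- by move=> v [V1v V2v]; have [] := PQ v V1v V2v.
Qed.

Lemma Omul_smooth : smooth (prodSpace (Omega pt) (Omega pt)) (Omega pt)
  (fun z => Omul z.1 z.2).
Proof.
move=> n U P [/Omega_lift p1 /Omega_lift p2]; apply: plot_fclass_vee => u Uu.
have [V1 [Q1 [V1u V1U pQ1 PQ1]]] := p1 u Uu.
have [V2 [Q2 [V2u V2U pQ2 PQ2]]] := p2 u Uu.
exists V1, V2, Q1, Q2; split=> // v /PQ1[s1 R1] /PQ2[s2 R2].
have [[_ e1 _] _] := Omega_rep R1; have [[_ _ e2] _] := Omega_rep R2.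
split=> //; first by rewrite e1 e2.
by have [] := Omul_rep R1 R2.
Qed.

Lemma Fvee_smooth : smooth (prodSpace (Fpt pt) (Omega pt)) (Fpt pt)
  (fun z => Fvee z.1 z.2).
Proof.
move=> n U P [/Fpt_lift p1 /Omega_lift p2]; apply: plot_fclass_vee => u Uu.
have [V1 [Q1 [V1u V1U pQ1 PQ1]]] := p1 u Uu.
have [V2 [Q2 [V2u V2U pQ2 PQ2]]] := p2 u Uu.
exists V1, V2, Q1, Q2; split=> // v /PQ1[s1 R1] /PQ2[s2 R2].
have [[_ e1 _] _] := Fpt_rep R1; have [[_ _ e2] _] := Omega_rep R2.
split=> //; first by rewrite e1 e2.
by have [] := Fvee_rep R1 R2.
Qed.

Lemma Oinv_smooth : smooth (Omega pt) (Omega pt) (@Oinv R X pt).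
Proof.
move=> n U P /Omega_lift pP; apply: plot_fclass_local => u /pP[V [Q [Vu VU pQ PQ]]].
exists V, (fun v => rpath (Q v)); split=> //; first exact: plot_rpath.
by move=> v /PQ[_ Rv]; have [] := Oinv_rep Rv.
Qed.

Lemma rpath_sits e a : sits e a -> sits e (rpath a).
Proof.
move=> sa t; rewrite evc_rpath.
have -> : ev (rpath a) i0 = ev a i1.
  by rewrite ev_evc evc_rpath sval_i0 subr0 evc_ge1.
have -> : ev (rpath a) i1 = ev a i0.
  by rewrite ev_evc evc_rpath sval_i1 subrr evc_le0.
by split=> te; [apply: (sa _).2|apply: (sa _).1]; lra.
Qed.

(** The inverse is obtained by choice, and injectivity of the shear makes it two-sided. It is smooth
    because [Fvee_div] expresses its loop component through lifts of the two given classes. *)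
Lemma shear_diffeomorphism :
  let shear (z : prodSpace (Fpt pt) (Omega pt)) : prodSpace (Fpt pt) (Fpt pt) :=
    (z.1, Fvee z.1 z.2) in
  diffeomorphism (prodSpace (Fpt pt) (Omega pt)) (image_space shear) (to_image shear).
Proof.
move=> shear; split.
  move=> n U P pP; split; first by have [] := pP.
  exact: Fvee_smooth pP.
have shear_inj : injective shear.
  move=> [p g] [q h] E; have /= pq := congr1 fst E; have /= pgh := congr1 snd E.
  rewrite -pq in pgh *; congr pair; apply: sval_inj.
  have Rh := Fvee_rep (FrepE p) (OrepE h).
  rewrite (Fvee_div (FrepE p) Rh); apply: Fvee_div (FrepE p) _.
  by rewrite pgh.
pose G (z : image_space shear) : prodSpace (Fpt pt) (Omega pt) :=
  projT1 (cid2 (svalP z)).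
have GK z : shear (G z) = sval z by rewrite /G; case: cid2.
exists G; split; last 2 first.
- by move=> z; apply: shear_inj; rewrite GK.
- by move=> z; apply: sval_inj; rewrite /= GK.
move=> n U P pP.
have p1 : plot (Fpt pt) U (fun u => (sval (P u)).1) := pP.1.
have p2 : plot (Fpt pt) U (fun u => (sval (P u)).2) := pP.2.
have G1 u : (G (P u)).1 = (sval (P u)).1 by rewrite -GK.
have G2 u : Fvee (G (P u)).1 (G (P u)).2 = (sval (P u)).2 by rewrite -[in RHS]GK.
split; first by apply: (plot_eq _ p1) => u _; rewrite -G1.
move: p1 p2 => /Fpt_lift p1 /Fpt_lift p2; apply: plot_fclass_vee => u Uu.
have [V1 [Q1 [V1u V1U pQ1 PQ1]]] := p1 u Uu.
have [V2 [Q2 [V2u V2U pQ2 PQ2]]] := p2 u Uu.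
exists V1, V2, (fun v => rpath (Q1 v)), Q2; split.
  by split=> //; exact: plot_rpath.
move=> v /PQ1[s1 R1] /PQ2[s2 R2]; rewrite -G1 in R1; rewrite -G2 in R2.
have [P1 _] := Fpt_rep R1; have [P2 _] := Fpt_rep R2; rewrite tau_Fvee in P2.
split=> //; first exact: rpath_sits.
  by have [_ -> _] := rpath_from_to P1; have [_ _ ->] := P2.
exact: Fvee_div R1 R2.
Qed.

(** Plots are total functions, so a section needs a value even where the path does not start at
    [pt]; the constant path supplies it. *)
Definition Fpt_of a : Fpt pt :=
  match pselect (Fpt_set pt (fclass a)) with
  | left h => exist _ _ h
  | right _ => exist _ _ (ex_intro2 _ _ (cpath pt) Oone_rep erefl)
  end.

Lemma Fpt_of_rep x a : path_from_to pt x a -> represents a (sval (Fpt_of a)).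
Proof.
move=> [sa a0 _]; rewrite /Fpt_of; case: pselect => //; case.
by exists a.
Qed.

Lemma tau_Fpt_of x a : path_from_to pt x a -> tau (Fpt_of a) = x.
Proof.
by move=> Pa; have [_ _ <-] := Pa; have [[_ _ <-]] := Fpt_rep (Fpt_of_rep Pa).
Qed.

(** * Local sections of the projection and the orbit space *)

Hypothesis hX : path_connected X.

(** An interval contains the segment between the two given parameters, so [segpath] turns the
    connecting plot into a sitting path on [0, 1]. *)
Lemma tau_surj x : exists p, tau p = x.
Proof.
have [I [P /= [_ iI pP [u Iu Pu] [v Iv Pv]]]] := hX pt x.
have star s : 0 <= s <= 1 -> [set w : 'rV[R]_1 | I (w 0 0)] (u + s *: (v - u)).
  move=> /andP[s0 s1] /=; rewrite !mxE.
  have [uv|vu] := leP (u 0 0) (v 0 0).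
    apply: (iI _ _ Iu Iv).
    have : 0 <= s * (v 0 0 - u 0 0) by rewrite mulr_ge0// subr_ge0.
    have : 0 <= (1 - s) * (v 0 0 - u 0 0) by rewrite mulr_ge0// subr_ge0.
    by rlra.
  apply: (iI _ _ Iv Iu).
  have : 0 <= s * (u 0 0 - v 0 0) by rewrite mulr_ge0// subr_ge0 ltW.
  have : 0 <= (1 - s) * (u 0 0 - v 0 0) by rewrite mulr_ge0 ?subr_ge0 ?(ltW vu).
  by rlra.
have [_] := segpathP pP star; rewrite Pu Pv => Pa.
by exists (Fpt_of (segpath P u v)); exact: tau_Fpt_of Pa.
Qed.

(** A ball contains the segments from its centre, so [segpath] is a plot on it. The fixed path [a]
    is smashed to have the width demanded by [plot_vee]. *)
Lemma tau_section n (U : set 'rV[R]_n) (P : 'rV[R]_n -> X) u :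
  plot X U P -> U u -> exists V (Q : 'rV[R]_n -> Fpt pt),
    [/\ V u, V `<=` U, plot (Fpt pt) V Q & forall v, V v -> tau (Q v) = P v].
Proof.
move=> pP Uu; have oU := plot_open pP.
have /nbhs_ballP[r /= r0 rU] : nbhs u U by exact: open_nbhs_nbhs.
have [p pu] := tau_surj (P u).
pose a := smash (Frep p).
have Pp := Frep_from_to p; have [sp _ _] := Pp.
have Pa : path_from_to pt (P u) a.
  by rewrite -pu; exact: reparam_from_to (reparam_smash sp) Pp.
have star v : ball u r v -> forall s, 0 <= s <= 1 -> U (u + s *: (v - u)).
  move=> ruv s /andP[s0 s1]; apply: rU; move: ruv; rewrite -ball_normE /ball_ /=.
  rewrite opprD addrA subrr add0r normrN normrZ ger0_norm// distrC.
  by apply: le_lt_trans; rewrite ler_piMl//.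
have Pv v : ball u r v -> path_from_to pt (P v) (vee (segpath P u v) a).
  by move=> /star/(segpathP pP)[_ Ps]; exact: vee_from_to Ps Pa.
have ob : open (ball u r) by exact: ball_open.
exists (ball u r), (fun v => Fpt_of (vee (segpath P u v) a)); split=> //.
- exact: ballxx.
- apply: plot_fclass_vee => v bv.
  exists (ball u r), (ball u r), (segpath P u), (fun=> a); split.
    by split=> //; [exact: (plot_segpath pP ob star)|exact: plot_cst].
  move=> w bw _; have [s1 [_ e1 _]] := segpathP pP (star w bw).
  split=> //; first exact: smash_sits.
    by rewrite e1; have [_ _ ->] := Pa.
  by have [] := Fpt_of_rep (Pv w bw).
- by move=> v /Pv; exact: tau_Fpt_of.
Qed.

(** Fibres of [tau] are orbits by [Fvee_transitive] and [tau_Fvee], so [X] and the orbit space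
    correspond as sets. Local sections make this bijection smooth in one direction, smoothness of
    [tau] in the other. *)
Lemma orbit_diffeomorphism :
  let orb (p q : Fpt pt) := exists g, q = Fvee p g in
  exists phi : X -> quotSpace orb,
    diffeomorphism X (quotSpace orb) phi /\ forall p, phi (tau p) = cls orb p.
Proof.
move=> orb.
have orb_cls p q : tau p = tau q -> cls orb p = cls orb q.
  move=> pq; apply: eq_cls; last exact: Fvee_transitive.
    by move=> p' q' [g ->]; apply: Fvee_transitive; rewrite tau_Fvee.
  by move=> q' p' r' [g ->] [h ->]; exists (Omul g h); rewrite FveeM.
pose phi x := cls orb (projT1 (cid (tau_surj x))).
have phiE p : phi (tau p) = cls orb p.
  by apply: orb_cls; case: cid.
pose psi (C : quotSpace orb) := tau (projT1 (cid (svalP C))).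
have psiE p : psi (cls orb p) = tau p.
  rewrite /psi; case: cid => q /= pq.
  have [g ->] : orb p q by rewrite pq; exists (Oone pt); rewrite Fvee1.
  by rewrite tau_Fvee.
exists phi; split=> //; split; last exists psi; last split.
- move=> n U P pP; split; first exact: plot_open pP.
  move=> u Uu; have [V [Q [Vu VU pQ QP]]] := tau_section pP Uu.
  by exists V, Q; split=> // v Vv; rewrite -phiE QP.
- move=> n U P [oU pP]; apply: plot_local => u /pP[V [Q [Vu VU pQ PQ]]].
  exists V; split=> //; apply: plot_eq (tau_smooth pQ) => v Vv.
  by rewrite /= PQ// psiE.
- by move=> x; have [p <-] := tau_surj x; rewrite phiE psiE.
- move=> C; have [p Cp] := svalP C.
  have -> : C = cls orb p by apply: sval_inj.
  by rewrite psiE phiE.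
Qed.

End bundle.

Theorem proposition3p8 (R : realType) (X : diffSpace R) (pt : X)
    (hX : path_connected X) :
  [/\ (forall (p : Fpt pt) (a : pathSpace X),
         represents a (sval p) -> tau p = ev a i1),
      (forall (p : Fpt pt) (g : Omega pt) (a c : pathSpace X),
         represents a (sval p) -> represents c (sval g) ->
         represents (vee a c) (sval (Fvee p g))),
      (forall (g h : Omega pt) (c s : pathSpace X),
         represents c (sval g) -> represents s (sval h) ->
         represents (vee c s) (sval (Omul g h))),
      (forall (g : Omega pt) (c : pathSpace X),
         represents c (sval g) -> represents (rpath c) (sval (Oinv g))) &
      principal_bundle (@Omul R X pt) (Oone pt) (@Oinv R X pt)
        (@tau R X pt) (@Fvee R X pt)].
Proof.
split.
- by move=> p a /Fpt_rep[[_ _ ->]].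
- exact: Fvee_rep.
- exact: Omul_rep.
- exact: Oinv_rep.
split.
- split; [exact: OmulA|exact: O1mul|exact: Omul1|exact: OVmul|exact: OmulV
    |exact: Omul_smooth|exact: Oinv_smooth].
- exact: tau_smooth.
- exact: tau_surj.
- exact: Fvee1.
- exact: FveeM.
- exact: Fvee_smooth.
- exact: shear_diffeomorphism.
- exact: orbit_diffeomorphism.
Qed.
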